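(* Let $q\in(0,1)$ and $\nu>-1$. Then the radius of starlikeness $r^*\left(h_{\nu}^{(3)}(\cdot;q)\right)$ of the function $$z\mapsto h_{\nu}^{(3)}(z;q)=c_{\nu}(q)z^{1-\frac{\nu}{2}}J_{\nu}^{(3)}(\sqrt{z};q)$$ is the smallest positive root of the equation $r\cdot \frac{d}{dr}J_{\nu}^{(3)}(r;q)-(\nu-2)J_{\nu}^{(3)}(r;q)=0$ and satisfies $$\frac{(1-q)(1-q^{\nu+1})}{2q}<r^*\left(h_{\nu}^{(3)}(\cdot;q)\right)<\frac{(q^2-1)(q^{\nu+1}-1)(q^{\nu+2}-1)}{q(q-q^{\nu+2}+2q^{\nu+3}-2)}$$ and $$\frac{(q-1)(q^{\nu+1}-1)}{2q}\sqrt{\frac{2(q^{\nu+2}-1)(q+1)}{q-q^{\nu+2}+2q^{\nu+3}-2}}<r^*\left(h_{\nu}^{(3)}(\cdot;q)\right)< \frac{(q^{\nu+1}-1)(q^{\nu+3}-1)(1-q)}{q(q+1)}\,q_4^*(\nu),$$ where $$q_4^*(\nu)=\frac{(q-q^{\nu+2}+2q^{\nu+3}-2)(q^3+2q^2+2q+1)} {q+q^2-q^3-4-5q^{\nu+2}+3q^{\nu+3}+10q^{\nu+4}+3q^{\nu+5}-5q^{\nu+6}-q^{2\nu+5}+q^{2\nu+6}+q^{2\nu+7}-4q^{2\nu+8}}.$$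
   Context: For $a\in\mathbb{C}$ and $q\in(0,1)$: $(a;q)_0=1$, $(a;q)_n=\prod_{k=1}^{n}(1-aq^{k-1})$, $(a;q)_\infty=\prod_{k\geq1}(1-aq^{k-1})$. The Hahn–Exton $q$-Bessel function is, for $\nu>-1$, $$J_{\nu}^{(3)}(z;q)=\frac{(q^{\nu+1};q)_{\infty}}{(q;q)_{\infty}}\sum_{n\geq0}\frac{(-1)^{n}z^{2n+\nu}}{(q;q)_{n}(q^{\nu+1};q)_{n}}q^{\frac{1}{2}n(n+1)},$$ and $c_{\nu}(q)=(q;q)_{\infty}/(q^{\nu+1};q)_{\infty}$; thus $h_\nu^{(3)}(z;q)=\sum_{n\ge0}\frac{(-1)^n q^{n(n+1)/2}}{(q;q)_n(q^{\nu+1};q)_n}z^{n+1}$ is entire with $h(0)=0$, $h'(0)=1$. For such $f$, the radius of starlikeness is $r^*(f)=\sup\{r>0:\ \mathrm{Re}\,(zf'(z)/f(z))>0 \text{ for all } |z|<r\}$.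
   Formalization: The radius of starlikeness is proved to be the square of the smallest positive root of the equation, not the root itself, because h is a function of z with J evaluated at the square root of z; for q = ν = 1/2 the literal claim contradicts the stated bounds. *)

(* Defs.v *)
From Stdlib Require Import Reals.
From Coquelicot Require Import Coquelicot.
Open Scope R_scope.

Fixpoint qpoch (a q : R) (n : nat) : R :=
  match n with
  | O => 1
  | S m => qpoch a q m * (1 - a * q ^ m)
  end.

Definition qpoch_inf (a q : R) : R := real (Lim_seq (fun n => qpoch a q n)).

Notation "q ^^ x" := (Rpower q x) (at level 30, right associativity).

Definition J3 (nu q r : R) : R :=
  qpoch_inf (q ^^ (nu + 1)) q / qpoch_inf q q *
  Series (fun n => (-1) ^ n * r ^^ (2 * INR n + nu) * q ^ (n * (n + 1) / 2)
                   / (qpoch q q n * qpoch (q ^^ (nu + 1)) q n)).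

Definition hcoef (nu q : R) (n : nat) : R :=
  (-1) ^ n * q ^ (n * (n + 1) / 2) / (qpoch q q n * qpoch (q ^^ (nu + 1)) q n).

Definition h3 (nu q : R) (z : C) : C :=
  (Series (fun n => hcoef nu q n * Re (pow_n z (S n))),
   Series (fun n => hcoef nu q n * Im (pow_n z (S n)))).

(* f is starlike on the disk |z| < r: Re(z f'(z)/f(z)) > 0 for 0 < |z| < r
   (at z = 0 the quotient is 1 by continuity for f(0)=0, f'(0)=1) *)
Definition starlike_on (f : C -> C) (r : R) : Prop :=
  forall z : C, 0 < Cmod z < r ->
    exists l : C, @is_derive C_AbsRing C_NormedModule f z l /\
                  0 < Re (Cmult z l / f z).

Definition is_radius_starlike (f : C -> C) (rs : R) : Prop :=
  is_lub (fun r => 0 < r /\ starlike_on f r) rs.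

(* Main.v *)
(* With b = q^(nu+1) one has h(z) = z g(z) for the entire function g(x) = sum_n qcoef b q n x^n, and
   r J'(r) - (nu-2) J(r) is a positive multiple of h'(r^2); so rho^2 is the first positive zero t of h'.

   The coefficients of g arise from those of (qx;q)_N (q-binomial theorem) by the multipliers
   (1 - b q^(j+n)) / (1 - b q^j), i.e. by the operators f(x) -> (f(x) - c f(qx)) / (1 - c) with 0 < c < 1.
   These preserve the polynomials with positive zeros of which consecutive ones have ratio at least 1/q,
   because the zeros of f(x) and f(qx) then interlace.  So g is a limit of polynomials with positive zeros,
   and by Rolle so is h'.  Two facts survive the limit: Re (z h'(z)/h(z)) >= r h'(r)/h(r) on |z| = r, which
   identifies t with the radius of starlikeness, and the Euler-Rayleigh inequalities
   1/t^k < sigma_k and t sigma_(k+1) < sigma_k for the power sums sigma_k of the inverse zeros of h'; these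
   stay strict because the second zero of the approximants of h' stays away from t and from infinity. *)
Require Import Defs.
From Stdlib Require Import Reals Lra Lia Psatz Arith ClassicalEpsilon.
From Coquelicot Require Import Coquelicot.
Open Scope R_scope.

(** * Polynomials [prod_(j < N) (1 - y j * x)] and their coefficients *)

Definition entire (c : nat -> R) : Prop := CV_radius c = p_infty.

Lemma entire_of_bounded (c : nat -> R) :
  (forall r, exists M, forall n, Rabs (c n * r ^ n) <= M) -> entire c.
Proof.
intros H. destruct (CV_radius_bounded c) as [ub _].
unfold entire. destruct (CV_radius c) as [x| |]; [exfalso| reflexivity |exfalso].
- specialize (ub (x + 1) (H _)). simpl in ub. lra.
- exact (ub 0 (H _)).
Qed.

Lemma entire_lt (c : nat -> R) x : entire c -> Rbar_lt (Rabs x) (CV_radius c).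
Proof. intros H; rewrite H; exact I. Qed.

Lemma entire_ex_pseries (c : nat -> R) x : entire c -> ex_pseries c x.
Proof. intros H; apply CV_radius_inside, entire_lt, H. Qed.

Lemma entire_ex_series_Rabs (c : nat -> R) x :
  entire c -> ex_series (fun n => Rabs (c n * x ^ n)).
Proof. intros H; apply CV_disk_inside, entire_lt, H. Qed.

Lemma entire_continuity (c : nat -> R) : entire c -> continuity (PSeries c).
Proof. intros H x; apply PSeries_continuity, entire_lt, H. Qed.

Lemma Rabs_le_sum_f_R0 (u : nat -> R) (N n : nat) :
  (n <= N)%nat -> Rabs (u n) <= sum_f_R0 (fun k => Rabs (u k)) N.
Proof.
induction N as [|N IH]; intros Hn.
- replace n with 0%nat by lia; simpl; lra.
- simpl. destruct (Nat.eq_dec n (S N)) as [->|E].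
  + assert (0 <= sum_f_R0 (fun k => Rabs (u k)) N)
      by (apply cond_pos_sum; intros; apply Rabs_pos). lra.
  + assert (n <= N)%nat by lia. specialize (IH H). pose proof (Rabs_pos (u (S N))). lra.
Qed.

Lemma entire_finite (c : nat -> R) N :
  (forall n, (N < n)%nat -> c n = 0) -> entire c.
Proof.
intros H. apply entire_of_bounded. intros r.
exists (sum_f_R0 (fun k => Rabs (c k * r ^ k)) N). intros n.
destruct (le_lt_dec n N) as [Hn|Hn].
- apply (Rabs_le_sum_f_R0 (fun k => c k * r ^ k)); exact Hn.
- rewrite H by exact Hn. rewrite Rmult_0_l, Rabs_R0.
  apply cond_pos_sum; intros; apply Rabs_pos.
Qed.

Lemma PSeries_finite (c : nat -> R) N x :
  (forall n, (N < n)%nat -> c n = 0) ->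
  PSeries c x = sum_f_R0 (fun k => c k * x ^ k) N.
Proof.
intros H. rewrite (PSeries_decr_n c N) by (apply entire_ex_pseries, (entire_finite c N), H).
rewrite (PSeries_ext (PS_decr_n c (S N)) (fun _ => 0)).
- rewrite PSeries_const_0. ring.
- intros n; apply H; lia.
Qed.

Definition dcoef (c : nat -> R) : nat -> R := PS_derive (PS_incr_1 c).

Lemma entire_dcoef (c : nat -> R) : entire c -> entire (dcoef c).
Proof. intros H. unfold entire, dcoef. rewrite CV_radius_derive, CV_radius_incr_1. exact H. Qed.

Lemma is_derive_mul_PSeries (c : nat -> R) x :
  entire c -> is_derive (fun x => x * PSeries c x) x (PSeries (dcoef c) x).
Proof.
intros H. apply (is_derive_ext (PSeries (PS_incr_1 c))); [intros; apply PSeries_incr_1|].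
apply is_derive_PSeries. rewrite CV_radius_incr_1. apply entire_lt, H.
Qed.

Definition mul_lin (c : nat -> R) (y : R) (n : nat) : R :=
  match n with O => c O | S k => c (S k) - y * c k end.

Lemma PSeries_mul_lin (c : nat -> R) y x :
  entire c -> PSeries (mul_lin c y) x = (1 - y * x) * PSeries c x.
Proof.
intros H. rewrite (PSeries_ext _ (PS_plus c (PS_scal (- y) (PS_incr_1 c)))).
- rewrite PSeries_plus, PSeries_scal, PSeries_incr_1; [ring | |].
  + apply entire_ex_pseries, H.
  + apply ex_pseries_scal; [apply Rmult_comm|].
    apply ex_pseries_incr_1, entire_ex_pseries, H.
- intros n. unfold PS_plus, PS_scal, PS_incr_1, plus, scal, zero; simpl; unfold mult; simpl.
  destruct n; simpl; ring.
Qed.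

Fixpoint lprod (y : nat -> R) (N : nat) (x : R) : R :=
  match N with O => 1 | S M => lprod y M x * (1 - y M * x) end.

Fixpoint lcoef (y : nat -> R) (N : nat) : nat -> R :=
  match N with
  | O => fun n => match n with O => 1 | S _ => 0 end
  | S M => mul_lin (lcoef y M) (y M)
  end.

Lemma lcoef_0 y N : lcoef y N 0 = 1.
Proof. induction N; [reflexivity | exact IHN]. Qed.

Lemma lcoef_gt y N n : (N < n)%nat -> lcoef y N n = 0.
Proof.
revert n; induction N as [|N IH]; intros [|n] Hn; try lia; simpl; [reflexivity|].
rewrite !IH by lia. ring.
Qed.

Lemma entire_lcoef y N : entire (lcoef y N).
Proof. apply (entire_finite _ N), lcoef_gt. Qed.

Lemma PSeries_lcoef y N x : PSeries (lcoef y N) x = lprod y N x.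
Proof.
induction N as [|N IH]; simpl.
- rewrite (PSeries_finite _ 0); simpl; [ring|]. intros [|n] H; [lia|reflexivity].
- rewrite PSeries_mul_lin by apply entire_lcoef. rewrite IH. ring.
Qed.

(* Coefficients of the power series quotient of [c] by [1 - y x]. *)
Fixpoint div_lin (c : nat -> R) (y : R) (n : nat) : R :=
  match n with O => c O | S k => c (S k) + y * div_lin c y k end.

Lemma mul_div_lin c y n : mul_lin (div_lin c y) y n = c n.
Proof. destruct n; simpl; ring. Qed.

Lemma div_lin_sum c y n :
  y <> 0 -> div_lin c y n = y ^ n * sum_f_R0 (fun k => c k * (/ y) ^ k) n.
Proof.
intros Hy; induction n as [|n IH]; simpl; [ring|].
rewrite IH. rewrite pow_inv. field. split; [apply pow_nonzero|]; exact Hy.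
Qed.

Lemma lcoef_of_roots (N : nat) (y c : nat -> R) :
  c 0%nat = 1 -> (forall n, (N < n)%nat -> c n = 0) ->
  (forall j, (j < N)%nat -> y j <> 0) ->
  (forall i j, (i < j < N)%nat -> y i <> y j) ->
  (forall j, (j < N)%nat -> PSeries c (/ y j) = 0) ->
  forall n, c n = lcoef y N n.
Proof.
revert c; induction N as [|N IH]; intros c H0 Hs Hy Hd Hr n; simpl.
- destruct n; [exact H0 | apply Hs; lia].
- assert (yN : y N <> 0) by (apply Hy; lia).
  assert (D : forall n, (N < n)%nat -> div_lin c (y N) n = 0).
  { assert (E : forall k, div_lin c (y N) (k + S N) = 0).
    { induction k as [|k IHk].
      - change (0 + S N)%nat with (S N). rewrite div_lin_sum by exact yN. rewrite <- PSeries_finite by exact Hs. rewrite Hr by lia. ring.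
      - change (S k + S N)%nat with (S (k + S N)). cbn [div_lin]. rewrite IHk, Hs by lia. ring. }
    intros m Hm. replace m with ((m - S N) + S N)%nat by lia. apply E. }
  rewrite <- (mul_div_lin c (y N)).
  assert (Q : forall n, div_lin c (y N) n = lcoef y N n).
  { apply IH; try (intros; apply Hy || apply Hd; lia); [exact H0 | exact D |].
    intros j Hj. assert (yj : y j <> 0) by (apply Hy; lia).
    assert (E := Hr j ltac:(lia)).
    rewrite (PSeries_ext c (mul_lin (div_lin c (y N)) (y N))) in E
      by (intros; symmetry; apply mul_div_lin).
    rewrite PSeries_mul_lin in E by (apply (entire_finite _ N), D).
    apply Rmult_integral in E; destruct E as [E|E]; [exfalso|exact E].
    apply (Hd j N); [lia|]. apply Rminus_diag_uniq_sym in E.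
    apply (Rmult_eq_reg_r (/ y j)); [|apply Rinv_neq_0_compat, yj].
    rewrite E. field. exact yj. }
  unfold mul_lin; destruct n; rewrite !Q; reflexivity.
Qed.

Lemma lprod_sign y N m x :
  (m <= N)%nat ->
  (forall j, (j < m)%nat -> 1 - y j * x <= 0) ->
  (forall j, (m <= j < N)%nat -> 0 <= 1 - y j * x) ->
  0 <= (-1) ^ m * lprod y N x.
Proof.
revert m; induction N as [|N IH]; intros m Hm H1 H2.
- replace m with 0%nat by lia; simpl; lra.
- simpl. destruct (Nat.eq_dec m (S N)) as [->|E].
  + assert (A : 0 <= (-1) ^ N * lprod y N x) by (apply IH; intros; try apply H1; lia).
    assert (B := H1 N ltac:(lia)). simpl. nra.
  + assert (A : 0 <= (-1) ^ m * lprod y N x).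
    { apply IH; intros; [lia|apply H1; lia|apply H2; lia]. }
    assert (B := H2 N ltac:(lia)). nra.
Qed.

(** * Zeros separated by a factor [1/q] *)

Lemma finite_choice (P : nat -> R -> Prop) N :
  (forall j, (j < N)%nat -> exists z, P j z) ->
  exists f : nat -> R, forall j, (j < N)%nat -> P j (f j).
Proof.
induction N as [|N IH]; intros H.
- exists (fun _ => 0); intros; lia.
- destruct IH as [f Hf]; [intros; apply H; lia|].
  destruct (H N ltac:(lia)) as [z Hz].
  exists (fun j => if Nat.eq_dec j N then z else f j). intros j Hj.
  destruct (Nat.eq_dec j N) as [->|E]; [exact Hz | apply Hf; lia].
Qed.

Lemma lprod_root y N j x : (j < N)%nat -> 1 - y j * x = 0 -> lprod y N x = 0.
Proof.
induction N as [|N IH]; intros Hj H; [lia|]; simpl.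
destruct (Nat.eq_dec j N) as [->|E]; [rewrite H; ring|].
rewrite IH by (lia || exact H). ring.
Qed.

Definition qsep (q : R) (y : nat -> R) (N : nat) : Prop :=
  (forall j, (j < N)%nat -> 0 < y j) /\
  (forall j, (S j < N)%nat -> y (S j) <= q * y j).

Lemma qsep_lt q y N i j :
  0 < q < 1 -> qsep q y N -> (i < j < N)%nat -> y j <= q * y i.
Proof.
intros Hq [Hp Hs] [Hij HjN]. induction j as [|j IH]; [lia|].
destruct (Nat.eq_dec i j) as [->|E]; [apply Hs; lia|].
specialize (IH ltac:(lia) ltac:(lia)). specialize (Hs j HjN).
assert (0 < y j) by (apply Hp; lia). nra.
Qed.

Lemma qsep_le q y N i j :
  0 < q < 1 -> qsep q y N -> (i <= j < N)%nat -> y j <= y i.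
Proof.
intros Hq H [Hij HjN]. destruct (Nat.eq_dec i j) as [->|E]; [lra|].
assert (A := qsep_lt q y N i j Hq H ltac:(lia)).
destruct H as [Hp _]. assert (0 < y i) by (apply Hp; lia). nra.
Qed.

Lemma qsep_sign q y N m x :
  0 < q < 1 -> qsep q y N -> (m <= N)%nat ->
  (forall i, m = S i -> 1 <= y i * x) ->
  ((m < N)%nat -> y m * x <= 1) -> 0 <= x ->
  0 <= (-1) ^ m * lprod y N x.
Proof.
intros Hq H Hm H1 H2 Hx. apply lprod_sign; [exact Hm | |]; intros j Hj.
- destruct m as [|i]; [lia|]. specialize (H1 i eq_refl).
  assert (A := qsep_le q y N j i Hq H ltac:(lia)). nra.
- assert (A := qsep_le q y N m j Hq H ltac:(lia)). specialize (H2 ltac:(lia)). nra.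
Qed.

Lemma PSeries_q_shift (c : nat -> R) (g q x : R) :
  entire c -> 
  PSeries (fun n => (1 - g * q ^ n) / (1 - g) * c n) x =
  (PSeries c x - g * PSeries c (q * x)) / (1 - g).
Proof.
intros Hc. unfold PSeries, Rdiv at 2. rewrite Rmult_comm.
rewrite <- Series_scal_l, <- Series_minus, <- Series_scal_l.
- apply Series_ext; intros n. rewrite Rpow_mult_distr. unfold Rdiv. ring.
- apply ex_pseries_R, entire_ex_pseries, Hc.
- apply (ex_series_scal g (fun n => c n * (q * x) ^ n)).
  apply ex_pseries_R, entire_ex_pseries, Hc.
Qed.

(* If the zeros of [f] grow at least geometrically with ratio [1/q], the zeros of [f(q x)]
   interlace with those of [f], so the sign changes of [f(x) - g f(q x)] locate one zero in each gap. *)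
Lemma qsep_multiplier (q g : R) (y : nat -> R) (N : nat) :
  0 < q < 1 -> 0 < g < 1 -> qsep q y N ->
  exists y', qsep q y' N /\ (forall j, (j < N)%nat -> y j <= y' j) /\
    forall n, (1 - g * q ^ n) / (1 - g) * lcoef y N n = lcoef y' N n.
Proof.
intros Hq Hg Hy.
set (c' := fun n => (1 - g * q ^ n) / (1 - g) * lcoef y N n).
assert (supp : forall n, (N < n)%nat -> c' n = 0).
{ intros n Hn. unfold c'. rewrite lcoef_gt by exact Hn. ring. }
assert (c0 : c' 0%nat = 1).
{ unfold c'. rewrite lcoef_0. simpl. field. lra. }
assert (ev : forall x, PSeries c' x = (lprod y N x - g * lprod y N (q * x)) / (1 - g)).
{ intros x. unfold c'. rewrite PSeries_q_shift by apply entire_lcoef.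
  rewrite !PSeries_lcoef. reflexivity. }
assert (pos := proj1 Hy).
assert (ypos : forall j, (j < N)%nat -> 0 < / y j) by (intros; apply Rinv_0_lt_compat, pos; assumption).
assert (Ig : 0 < / (1 - g)) by (apply Rinv_0_lt_compat; lra).
assert (sq : forall j, (-1) ^ j * (-1) ^ j = 1).
{ intros j. rewrite <- Rpow_mult_distr. replace (-1 * -1) with 1 by ring. apply pow1. }
set (a := fun j => match j with O => 0 | S i => / (q * y i) end).
assert (a_nonneg : forall j, (j < N)%nat -> 0 <= a j).
{ intros [|i] Hj; simpl; [lra|]. left; apply Rinv_0_lt_compat.
  apply Rmult_lt_0_compat; [lra|apply pos; lia]. }
assert (ab : forall j, (j < N)%nat -> a j <= / y j).
{ intros [|i] Hj; simpl.
  - left; apply ypos, Hj.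
  - apply Rinv_le_contravar; [apply pos, Hj|]. apply (proj2 Hy), Hj. }
assert (fa : forall j, (j < N)%nat -> 0 <= (-1) ^ j * PSeries c' (a j)).
{ intros j Hj. rewrite ev.
  enough (0 <= (-1) ^ j * (lprod y N (a j) - g * lprod y N (q * a j))).
  { unfold Rdiv. rewrite <- Rmult_assoc. apply Rmult_le_pos; [assumption|lra]. }
  destruct j as [|i]; unfold a.
  - rewrite Rmult_0_r, <- !PSeries_lcoef, PSeries_0, lcoef_0. simpl. lra.
  - assert (yi : 0 < y i) by (apply pos; lia).
    rewrite (lprod_root y N i (q * / (q * y i))) by (lia || field; lra).
    rewrite Rmult_0_r, Rminus_0_r.
    apply (qsep_sign q); try assumption; try lia.
    + intros k [= <-]. replace (y i * / (q * y i)) with (/ q) by (field; lra).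
      left. rewrite <- Rinv_1. apply Rinv_lt_contravar; lra.
    + intros _. apply (Rmult_le_reg_r (q * y i)); [nra|].
      rewrite Rmult_assoc, Rinv_l by nra. rewrite Rmult_1_r, Rmult_1_l. apply (proj2 Hy), Hj.
    + apply (a_nonneg (S i)), Hj. }
assert (fb : forall j, (j < N)%nat -> (-1) ^ j * PSeries c' (/ y j) <= 0).
{ intros j Hj. rewrite ev. assert (yj := pos j Hj).
  rewrite (lprod_root y N j (/ y j)) by (lia || field; lra).
  assert (A : 0 <= (-1) ^ j * lprod y N (q * / y j)).
  { apply (qsep_sign q); try assumption; try lia.
    - intros i ->. apply (Rmult_le_reg_r (y (S i))); [exact yj|].
      rewrite Rmult_1_l, <- !Rmult_assoc, Rmult_assoc, Rinv_l, Rmult_1_r, Rmult_comm by lra.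
      apply (proj2 Hy), Hj.
    - intros _. replace (y j * (q * / y j)) with q by (field; lra). lra.
    - apply Rmult_le_pos; [lra|left; apply ypos, Hj]. }
  assert (0 <= (-1) ^ j * lprod y N (q * / y j) * (g * / (1 - g))) by (apply Rmult_le_pos; nra).
  unfold Rdiv. nra. }
destruct (finite_choice (fun j z => a j <= z <= / y j /\ PSeries c' z = 0) N) as [z Hz].
{ intros j Hj. destruct (IVT_cor (PSeries c') (a j) (/ y j)) as [z Hz].
  - apply entire_continuity, (entire_finite _ N), supp.
  - apply ab, Hj.
  - specialize (fa j Hj). specialize (fb j Hj). specialize (sq j).
    replace (PSeries c' (a j) * PSeries c' (/ y j)) with
      (((-1) ^ j * PSeries c' (a j)) * ((-1) ^ j * PSeries c' (/ y j))) by
      (transitivity ((-1) ^ j * (-1) ^ j * (PSeries c' (a j) * PSeries c' (/ y j)));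
        [ring | rewrite sq; ring]).
    nra.
  - exists z; exact Hz. }
assert (zpos : forall j, (j < N)%nat -> 0 < z j).
{ intros j Hj. destruct (Hz j Hj) as [[Ha _] Z]. specialize (a_nonneg j Hj).
  destruct (Rle_lt_or_eq_dec 0 (z j)) as [|E]; [lra|assumption|].
  rewrite <- E, PSeries_0, c0 in Z. lra. }
exists (fun j => / z j).
assert (Q : qsep q (fun j => / z j) N).
{ split; [intros; apply Rinv_0_lt_compat, zpos; assumption|]. intros j Hj.
  destruct (Hz j ltac:(lia)) as [[_ H1] _]. destruct (Hz (S j) Hj) as [[H2 _] _].
  simpl in H2. assert (P1 := pos j ltac:(lia)). assert (P2 := zpos j ltac:(lia)).
  assert (z j <= q * z (S j)).
  { eapply Rle_trans; [exact H1|]. apply (Rmult_le_reg_l (/ q)); [apply Rinv_0_lt_compat; lra|].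
    rewrite <- Rmult_assoc, Rinv_l, Rmult_1_l by lra. rewrite <- Rinv_mult. exact H2. }
  assert (P3 := zpos (S j) Hj).
  apply (Rmult_le_reg_r (z j * z (S j))); [apply Rmult_lt_0_compat; assumption|].
  replace (/ z (S j) * (z j * z (S j))) with (z j) by (field; lra).
  replace (q * / z j * (z j * z (S j))) with (q * z (S j)) by (field; lra). exact H. }
split; [exact Q | split].
- intros j Hj. destruct (Hz j Hj) as [[_ H1] _].
  rewrite <- (Rinv_inv (y j)). apply Rinv_le_contravar; [apply zpos, Hj | exact H1].
- intros n. change (c' n = lcoef (fun j => / z j) N n).
  apply lcoef_of_roots; try assumption.
  + intros j Hj. apply Rinv_neq_0_compat. specialize (zpos j Hj). lra.
  + intros i j Hij. assert (A := qsep_lt _ _ _ i j Hq Q Hij). simpl in A.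
    assert (0 < / z i) by (apply (proj1 Q); lia). nra.
  + intros j Hj. rewrite Rinv_inv. apply Hz, Hj.
Qed.

Lemma lcoef_deriv_roots (q : R) (y : nat -> R) (N : nat) :
  0 < q < 1 -> qsep q y N ->
  exists v, (forall j, (j < N)%nat -> y j < v j) /\
    (forall j, (S j < N)%nat -> v (S j) < y j) /\
    forall n, dcoef (lcoef y N) n = lcoef v N n.
Proof.
intros Hq Hy. assert (pos := proj1 Hy).
set (c' := dcoef (lcoef y N)).
assert (der : forall x, derivable_pt_lim (fun x => x * PSeries (lcoef y N) x) x (PSeries c' x)).
{ intros x. apply is_derive_Reals, is_derive_mul_PSeries, entire_lcoef. }
set (a := fun j => match j with O => 0 | S i => / y i end).
destruct (finite_choice (fun j z => a j < z < / y j /\ PSeries c' z = 0) N) as [z Hz].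
{ intros j Hj. assert (yj := pos j Hj).
  assert (ab : a j < / y j).
  { destruct j as [|i]; simpl; [apply Rinv_0_lt_compat, yj|].
    assert (yi := pos i ltac:(lia)). apply Rinv_lt_contravar; [apply Rmult_lt_0_compat; assumption|].
    assert (A := proj2 Hy i Hj). nra. }
  destruct (MVT_cor2 _ _ _ _ ab (fun x _ => der x)) as [z [E Hz]].
  exists z; split; [exact Hz|]. rewrite !PSeries_lcoef in E.
  rewrite (lprod_root y N j (/ y j)) in E by (lia || field; lra).
  assert (F : a j * lprod y N (a j) = 0).
  { destruct j as [|i]; simpl; [ring|]. assert (yi := pos i ltac:(lia)).
    rewrite (lprod_root y N i (/ y i)) by (lia || field; lra). ring. }
  rewrite F in E. assert (G : PSeries c' z * (/ y j - a j) = 0) by lra.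
  apply Rmult_integral in G. destruct G; [assumption|lra]. }
assert (zpos : forall j, (j < N)%nat -> 0 < z j).
{ intros j Hj. destruct (Hz j Hj) as [[H _] _]. eapply Rle_lt_trans; [|exact H].
  destruct j as [|i]; simpl; [lra|]. left; apply Rinv_0_lt_compat, pos; lia. }
assert (V1 : forall j, (j < N)%nat -> y j < / z j).
{ intros j Hj. destruct (Hz j Hj) as [[_ H] _]. specialize (zpos j Hj). specialize (pos j Hj).
  rewrite <- (Rinv_inv (y j)). apply Rinv_lt_contravar; [|exact H].
  apply Rmult_lt_0_compat; [|apply Rinv_0_lt_compat]; assumption. }
assert (V2 : forall j, (S j < N)%nat -> / z (S j) < y j).
{ intros j Hj. destruct (Hz (S j) Hj) as [[H _] _]. simpl in H.
  specialize (zpos (S j) Hj). specialize (pos j ltac:(lia)).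
  rewrite <- (Rinv_inv (y j)). apply Rinv_lt_contravar; [|exact H].
  apply Rmult_lt_0_compat; [apply Rinv_0_lt_compat|]; assumption. }
exists (fun j => / z j). split; [exact V1 | split; [exact V2|]].
intros n. change (c' n = lcoef (fun j => / z j) N n).
apply lcoef_of_roots.
- unfold c', dcoef, PS_derive, PS_incr_1. rewrite lcoef_0. simpl. ring.
- intros m Hm. unfold c', dcoef, PS_derive, PS_incr_1. rewrite lcoef_gt by exact Hm. ring.
- intros j Hj. apply Rinv_neq_0_compat. specialize (zpos j Hj). lra.
- intros i j [Hij HjN]. destruct j as [|j]; [lia|].
  assert (A := V2 j HjN). assert (B := V1 i ltac:(lia)).
  assert (C := qsep_le q y N i j Hq Hy ltac:(lia)). lra.
- intros j Hj. rewrite Rinv_inv. apply Hz, Hj.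
Qed.

(** * Polynomial approximants *)

Lemma qpoch_pos a q n : 0 < q < 1 -> 0 < a < 1 -> 0 < qpoch a q n <= 1.
Proof.
intros Hq Ha. induction n as [|n IH]; simpl; [lra|].
assert (0 < q ^ n <= 1).
{ split; [apply pow_lt; lra|]. rewrite <- (pow1 n). apply pow_incr; lra. }
assert (0 < a * q ^ n < 1) by nra. nra.
Qed.

Lemma qpoch_add a q m n : qpoch a q (m + n) = qpoch a q m * qpoch (a * q ^ m) q n.
Proof.
induction n as [|n IH]; [rewrite Nat.add_0_r; simpl; ring|].
rewrite Nat.add_succ_r. simpl. rewrite IH, pow_add. ring.
Qed.

Lemma qpoch_lim (u : nat -> R) q n :
  is_lim_seq u 0 -> is_lim_seq (fun N => qpoch (u N) q n) 1.
Proof.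
intros H. induction n as [|n IH]; simpl; [apply is_lim_seq_const|].
replace (Finite 1) with (Finite (1 * (1 - 0 * q ^ n))) by (f_equal; ring).
apply is_lim_seq_mult'; [exact IH|]. apply is_lim_seq_minus'; [apply is_lim_seq_const|].
apply is_lim_seq_mult'; [exact H | apply is_lim_seq_const].
Qed.

Lemma pow_lim_0 q : 0 < q < 1 -> is_lim_seq (fun N => q ^ N) 0.
Proof. intros Hq. apply is_lim_seq_geom. rewrite Rabs_pos_eq; lra. Qed.

Lemma qpoch_inv_bound q N n : 0 < q < 1 -> 0 <= qpoch (q ^ N) (/ q) n <= 1.
Proof.
intros Hq.
assert (fac : forall k, (k <= N)%nat -> q ^ N * (/ q) ^ k = q ^ (N - k)).
{ intros k Hk. replace N with ((N - k) + k)%nat at 1 by lia. rewrite pow_add, pow_inv.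
  field. apply pow_nonzero; lra. }
assert (Z : forall k, (N < k)%nat -> qpoch (q ^ N) (/ q) k = 0).
{ induction k as [|k IH]; intros Hk; [lia|]. simpl. destruct (Nat.eq_dec k N) as [->|E].
  - rewrite fac, Nat.sub_diag by lia. simpl. ring.
  - rewrite IH by lia. ring. }
induction n as [|n IH]; simpl; [lra|]. destruct (le_lt_dec n N) as [Hn|Hn].
- rewrite fac by exact Hn.
  assert (0 < q ^ (N - n) <= 1).
  { split; [apply pow_lt; lra|]. rewrite <- (pow1 (N - n)). apply pow_incr; lra. }
  nra.
- rewrite Z by exact Hn. lra.
Qed.

Lemma triangular_succ n : (S n * (S n + 1) / 2 = n * (n + 1) / 2 + S n)%nat.
Proof.
replace (S n * (S n + 1))%nat with (n * (n + 1) + S n * 2)%nat by lia.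
apply Nat.div_add; lia.
Qed.

(* [qpoch (q ^ N) (/ q) n] is the falling product [(1-q^N)...(1-q^(N-n+1))]. *)
Lemma lcoef_q_binomial q N n : 0 < q < 1 ->
  lcoef (fun j => q ^ S j) N n =
  (-1) ^ n * q ^ (n * (n + 1) / 2) / qpoch q q n * qpoch (q ^ N) (/ q) n.
Proof.
intros Hq. revert n; induction N as [|N IH]; intros n.
- destruct n as [|n]; [simpl; field|]. simpl lcoef.
  replace (qpoch (q ^ 0) (/ q) (S n)) with 0; [ring|].
  induction n as [|n IHn]; [simpl; ring|].
  change (0 = qpoch (q ^ 0) (/ q) (S n) * (1 - q ^ 0 * (/ q) ^ S n)). rewrite <- IHn. ring.
- destruct n as [|n].
  + rewrite lcoef_0. simpl. field.
  + simpl lcoef. unfold mul_lin. rewrite !IH.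
    assert (W : qpoch (q ^ S N) (/ q) (S n) = (1 - q ^ S N) * qpoch (q ^ N) (/ q) n).
    { change (S n) with (1 + n)%nat. rewrite qpoch_add. simpl.
      replace (q * q ^ N * (/ q * 1)) with (q ^ N) by (field; lra). ring. }
    rewrite W, triangular_succ, pow_add. cbn [qpoch].
    assert (P := qpoch_pos q q n Hq Hq).
    assert (Qn : 0 < q ^ n <= 1).
    { split; [apply pow_lt; lra|]. rewrite <- (pow1 n). apply pow_incr; lra. }
    rewrite pow_inv. simpl. field. repeat split; nra.
Qed.

Lemma qsep_multipliers (q b : R) (y : nat -> R) (N M : nat) :
  0 < q < 1 -> 0 < b < 1 -> qsep q y N ->
  exists y', qsep q y' N /\ (forall j, (j < N)%nat -> y j <= y' j) /\
    forall n, qpoch (b * q ^ n) q M / qpoch b q M * lcoef y N n = lcoef y' N n.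
Proof.
intros Hq Hb Hy. induction M as [|M [y1 [S1 [L1 E1]]]].
- exists y; split; [exact Hy|split; [intros; lra|]]. intros n; simpl; field.
- assert (Hg : 0 < b * q ^ M < 1).
  { assert (0 < q ^ M <= 1).
    { split; [apply pow_lt; lra|]. rewrite <- (pow1 M). apply pow_incr; lra. } nra. }
  destruct (qsep_multiplier q (b * q ^ M) y1 N Hq Hg S1) as [y2 [S2 [L2 E2]]].
  exists y2; split; [exact S2|split].
  + intros j Hj. specialize (L1 j Hj). specialize (L2 j Hj). lra.
  + intros n. rewrite <- E2, <- E1. simpl.
    assert (P := qpoch_pos b q M Hq Hb). field. lra.
Qed.

Definition qcoef (b q : R) (n : nat) : R :=
  (-1) ^ n * q ^ (n * (n + 1) / 2) / (qpoch q q n * qpoch b q n).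

Lemma qcoef_S b q n : 0 < q < 1 -> 0 < b < 1 ->
  qcoef b q (S n) = - (q ^ S n / ((1 - q ^ S n) * (1 - b * q ^ n))) * qcoef b q n.
Proof.
intros Hq Hb. unfold qcoef. rewrite triangular_succ, pow_add.
assert (P1 := qpoch_pos q q n Hq Hq). assert (P2 := qpoch_pos b q n Hq Hb).
assert (Qn : 0 < q ^ n <= 1).
{ split; [apply pow_lt; lra|]. rewrite <- (pow1 n). apply pow_incr; lra. }
simpl. field. repeat split; nra.
Qed.

Lemma qcoef_neq_0 b q n : 0 < q < 1 -> 0 < b < 1 -> qcoef b q n <> 0.
Proof.
intros Hq Hb. unfold qcoef, Rdiv.
assert (P1 := qpoch_pos q q n Hq Hq). assert (P2 := qpoch_pos b q n Hq Hb).
repeat apply Rmult_integral_contrapositive_currified.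
- apply pow_nonzero; lra.
- apply pow_nonzero; lra.
- apply Rinv_neq_0_compat. nra.
Qed.

Lemma entire_qcoef b q : 0 < q < 1 -> 0 < b < 1 -> entire (qcoef b q).
Proof.
intros Hq Hb. apply CV_radius_infinite_DAlembert; [intros; apply qcoef_neq_0; assumption|].
apply (is_lim_seq_le_le (fun _ => 0) _ (fun n => q ^ n * (q / ((1 - q) * (1 - b))))).
- intros n. split; [apply Rabs_pos|].
  rewrite qcoef_S by assumption. unfold Rdiv at 1.
  rewrite Rmult_assoc, Rinv_r, Rmult_1_r by (apply qcoef_neq_0; assumption).
  rewrite Rabs_Ropp.
  assert (Qn : 0 < q ^ n <= 1).
  { split; [apply pow_lt; lra|]. rewrite <- (pow1 n). apply pow_incr; lra. }
  assert (0 < (1 - q) * (1 - b)) by nra.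
  assert ((1 - q) * (1 - b) <= (1 - q ^ S n) * (1 - b * q ^ n)).
  { simpl. apply Rmult_le_compat; nra. }
  rewrite Rabs_pos_eq.
  + simpl. unfold Rdiv. replace (q * q ^ n) with (q ^ n * q) by ring.
    rewrite Rmult_assoc. apply Rmult_le_compat_l; [lra|].
    apply Rmult_le_compat_l; [lra|]. apply Rinv_le_contravar; [assumption|].
    simpl in *. replace (q ^ n * q) with (q * q ^ n) by ring. assumption.
  + apply Rmult_le_pos; [apply pow_le; lra|]. left; apply Rinv_0_lt_compat. lra.
- apply is_lim_seq_const.
- replace (Finite 0) with (Finite (0 * (q / ((1 - q) * (1 - b))))) by (f_equal; ring).
  apply is_lim_seq_mult'; [apply pow_lim_0, Hq | apply is_lim_seq_const].
Qed.

Definition qapprox (b q : R) (N n : nat) : R :=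
  qcoef b q n * (qpoch (q ^ N) (/ q) n * qpoch (b * q ^ N) q n).

Lemma qapprox_roots b q N : 0 < q < 1 -> 0 < b < 1 ->
  exists y, qsep q y N /\ (forall j, (j < N)%nat -> q ^ S j <= y j) /\
    forall n, qapprox b q N n = lcoef y N n.
Proof.
intros Hq Hb.
assert (S0 : qsep q (fun j => q ^ S j) N).
{ split; intros j Hj; [apply pow_lt; lra | simpl; lra]. }
destruct (qsep_multipliers q b _ N N Hq Hb S0) as [y [Sy [Ly Ey]]].
exists y; split; [exact Sy|split; [exact Ly|]]. intros n.
rewrite <- Ey, lcoef_q_binomial by exact Hq.
assert (P0 := qpoch_pos q q n Hq Hq). assert (P1 := qpoch_pos b q n Hq Hb).
assert (P2 := qpoch_pos b q N Hq Hb).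
assert (E : qpoch b q n * qpoch (b * q ^ n) q N = qpoch b q N * qpoch (b * q ^ N) q n).
{ rewrite <- !qpoch_add. f_equal. lia. }
unfold qapprox, qcoef.
replace (qpoch (b * q ^ N) q n) with (qpoch b q n * qpoch (b * q ^ n) q N / qpoch b q N)
  by (rewrite E; field; lra).
field. lra.
Qed.

Lemma qapprox_bound b q N n : 0 < q < 1 -> 0 < b < 1 ->
  Rabs (qapprox b q N n) <= Rabs (qcoef b q n).
Proof.
intros Hq Hb. unfold qapprox. rewrite Rabs_mult.
assert (A := qpoch_inv_bound q N n Hq).
assert (B : 0 < qpoch (b * q ^ N) q n <= 1).
{ apply qpoch_pos; [exact Hq|].
  assert (0 < q ^ N <= 1).
  { split; [apply pow_lt; lra|]. rewrite <- (pow1 N). apply pow_incr; lra. } nra. }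
rewrite (Rabs_pos_eq (_ * _)) by nra.
assert (C := Rabs_pos (qcoef b q n)). assert (qpoch (q ^ N) (/ q) n * qpoch (b * q ^ N) q n <= 1) by nra.
nra.
Qed.

Lemma qapprox_lim b q n : 0 < q < 1 -> is_lim_seq (fun N => qapprox b q N n) (qcoef b q n).
Proof.
intros Hq. unfold qapprox. replace (Finite (qcoef b q n)) with (Finite (qcoef b q n * (1 * 1))) by (f_equal; ring).
apply is_lim_seq_mult'; [apply is_lim_seq_const|].
apply is_lim_seq_mult'; apply qpoch_lim; [apply pow_lim_0, Hq|].
replace (Finite 0) with (Finite (b * 0)) by (f_equal; ring).
apply is_lim_seq_mult'; [apply is_lim_seq_const | apply pow_lim_0, Hq].
Qed.

Lemma ex_series_le_R (a b : nat -> R) :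
  (forall n, Rabs (a n) <= b n) -> ex_series b -> ex_series a.
Proof. exact (@ex_series_le R_AbsRing R_CompleteNormedModule a b). Qed.

Lemma is_lim_seq_Series (d : nat -> nat -> R) (l M : nat -> R) :
  (forall N n, Rabs (d N n) <= M n) ->
  (forall n, is_lim_seq (fun N => d N n) (l n)) -> ex_series M ->
  is_lim_seq (fun N => Series (d N)) (Series l).
Proof.
intros Hd Hl HM.
assert (lM : forall n, Rabs (l n) <= M n).
{ intros n. apply (is_lim_seq_le (fun N => Rabs (d N n)) (fun _ => M n) (Rabs (l n)) (M n)).
  - intros; apply Hd.
  - apply (is_lim_seq_abs _ (l n)), Hl.
  - apply is_lim_seq_const. }
assert (exd : forall N, ex_series (d N)) by (intros; apply (ex_series_le_R _ M); [intros; apply Hd|exact HM]).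
assert (exl : ex_series l) by (apply (ex_series_le_R _ M); [exact lM|exact HM]).
set (e := fun N n => Rabs (d N n - l n)).
assert (e2 : forall N n, 0 <= e N n <= 2 * M n).
{ intros N n. unfold e. split; [apply Rabs_pos|].
  assert (A := Rabs_triang (d N n) (- l n)). rewrite Rabs_Ropp in A.
  specialize (Hd N n). specialize (lM n). unfold Rminus. lra. }
assert (HM2 : ex_series (fun n => 2 * M n)) by (apply (ex_series_scal 2 M), HM).
assert (exe : forall N, ex_series (e N)).
{ intros N. apply (ex_series_le_R _ (fun n => 2 * M n)); [|exact HM2].
  intros n. change (Rabs (e N n) <= 2 * M n). rewrite Rabs_pos_eq; apply e2. }
assert (tail : is_lim_seq (fun K => Series (fun n => 2 * M n) - sum_f_R0 (fun n => 2 * M n) K) 0).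
{ replace (Finite 0) with (Finite (Series (fun n => 2 * M n) - Series (fun n => 2 * M n))) by (f_equal; ring).
  apply is_lim_seq_minus'; [apply is_lim_seq_const|].
  apply (is_lim_seq_ext (sum_n (fun n => 2 * M n))); [intros; apply sum_n_Reals|].
  apply (Series_correct _ HM2). }
assert (fin : forall K, is_lim_seq (fun N => sum_f_R0 (e N) K) 0).
{ assert (e0 : forall n, is_lim_seq (fun N => e N n) 0).
  { intros n. unfold e. replace (Finite 0) with (Rbar_abs (l n - l n)) by (simpl; rewrite Rminus_diag, Rabs_R0; reflexivity).
    apply (is_lim_seq_abs _ (l n - l n)). apply is_lim_seq_minus'; [apply Hl|apply is_lim_seq_const]. }
  induction K as [|K IH]; simpl; [apply e0|].
  replace (Finite 0) with (Finite (0 + 0)) by (f_equal; ring). apply is_lim_seq_plus'; [exact IH|apply e0]. }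
apply is_lim_seq_spec. intros eps. apply is_lim_seq_spec in tail.
destruct (tail (pos_div_2 eps)) as [K HK]. specialize (HK K (le_n _)).
specialize (fin K). apply is_lim_seq_spec in fin.
destruct (fin (pos_div_2 eps)) as [N0 HN]. exists N0. intros N hN. specialize (HN N hN).
rewrite <- Series_minus by auto.
eapply Rle_lt_trans; [apply Series_Rabs, exe|]. change (Series (e N) < eps).
rewrite (Series_incr_n (e N) (S K)) by (lia || apply exe). simpl pred.
rewrite (Series_incr_n (fun n => 2 * M n) (S K)) in HK by (lia || exact HM2). simpl pred in HK.
assert (T : Series (fun k => e N (S K + k)%nat) <= Series (fun k => 2 * M (S K + k)%nat)).
{ apply Series_le; [intros; apply e2|]. apply (ex_series_incr_n (fun n => 2 * M n) (S K)), HM2. }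
rewrite Rminus_0_r in HN. simpl in HN, HK. apply Rabs_def2 in HN, HK.
simpl in *. lra.
Qed.

(** * Limits of polynomials with positive zeros *)

Lemma continuity_pos_near (f : R -> R) x :
  continuity_pt f x -> 0 < f x ->
  exists d, 0 < d /\ forall z, Rabs (z - x) < d -> 0 < f z.
Proof.
intros Hf Hx. destruct (Hf (f x) Hx) as [d [Hd H]]. exists d; split; [exact Hd|].
intros z Hz. destruct (Req_dec x z) as [<-|E]; [exact Hx|].
specialize (H z). simpl in H. unfold R_dist, D_x, no_cond in H.
assert (A := H (conj (conj I E) Hz)). apply Rabs_def2 in A. lra.
Qed.

Lemma first_zero (f : R -> R) x0 :
  continuity f -> 0 < f 0 -> 0 < x0 -> f x0 <= 0 ->
  exists t, 0 < t <= x0 /\ f t = 0 /\ forall s, 0 <= s < t -> 0 < f s.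
Proof.
intros Hc H0 Hx0 Hf.
set (E := fun x => 0 <= x <= x0 /\ forall s, 0 <= s <= x -> 0 < f s).
assert (E0 : E 0) by (split; [lra|]; intros s Hs; replace s with 0 by lra; exact H0).
destruct (completeness E) as [t [ub lub]].
- exists x0; intros x [[_ H] _]; exact H.
- exists 0; exact E0.
- assert (t0 : 0 <= t) by (apply ub, E0).
  assert (tx : t <= x0) by (apply lub; intros x [[_ H] _]; exact H).
  assert (below : forall s, 0 <= s < t -> 0 < f s).
  { intros s Hs. destruct (Rlt_dec 0 (f s)) as [H|H]; [exact H|exfalso].
    assert (t <= s); [|lra]. apply lub. intros x [Hx Hpos].
    destruct (Rle_dec x s) as [A|A]; [exact A|]. exfalso; apply H, Hpos; lra. }
  assert (ft : f t = 0).
  { destruct (Rtotal_order (f t) 0) as [L|[L|L]]; [exfalso|exact L|exfalso].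
    - destruct (continuity_pos_near (fun x => - f x) t) as [d [Hd Hn]]; [|lra|].
      { apply continuity_pt_opp, Hc. }
      assert (0 < t) by (destruct t0 as [? | <-]; [assumption|lra]).
      set (s := Rmax 0 (t - d / 2)).
      assert (Hs : 0 <= s < t) by (unfold s; split; [apply Rmax_l|apply Rmax_lub_lt; lra]).
      assert (t - d / 2 <= s) by apply Rmax_r.
      assert (0 < - f s) by (apply Hn, Rabs_def1; lra). specialize (below s Hs). lra.
    - destruct (continuity_pos_near f t (Hc t) L) as [d [Hd Hn]].
      set (s := Rmin x0 (t + d / 2)).
      assert (t < x0) by (destruct tx as [? | ->]; [assumption|lra]).
      assert (t < s) by (apply Rmin_glb_lt; lra).
      assert (s <= t + d / 2) by apply Rmin_r.
      assert (E s); [|assert (s <= t) by (apply ub; assumption); lra].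
      split; [split; [lra|apply Rmin_l]|]. intros r Hr.
      destruct (Rlt_dec r t); [apply below; lra|]. apply Hn, Rabs_def1; lra. }
  exists t; split; [|split; assumption]. split; [|exact tx].
  destruct t0 as [? | <-]; [assumption|lra].
Qed.

(* "lp" stands for Laguerre-Polya; [y N j], [j < N], are the inverse zeros of the [N]-th approximant. *)
Definition lp_approx (c : nat -> R) (y : nat -> nat -> R) : Prop :=
  entire c /\
  (forall N n, Rabs (lcoef (y N) N n) <= Rabs (c n)) /\
  (forall n, is_lim_seq (fun N => lcoef (y N) N n) (c n)) /\
  (forall N j, (j < N)%nat -> 0 < y N j).

Lemma lp_lim_weighted c y (w W : nat -> R) :
  lp_approx c y -> (forall n, Rabs (w n) <= W n) ->
  ex_series (fun n => Rabs (c n) * W n) ->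
  is_lim_seq (fun N => Series (fun n => lcoef (y N) N n * w n)) (Series (fun n => c n * w n)).
Proof.
intros [Hc [Hb [Hl _]]] Hw HW.
apply (is_lim_seq_Series _ _ (fun n => Rabs (c n) * W n)); [| |exact HW].
- intros N n. rewrite Rabs_mult. apply Rmult_le_compat; auto using Rabs_pos.
- intros n. apply (is_lim_seq_scal_r _ (w n) (c n)), Hl.
Qed.

Lemma lp_lim c y x :
  lp_approx c y -> is_lim_seq (fun N => lprod (y N) N x) (PSeries c x).
Proof.
intros H. apply (is_lim_seq_ext (fun N => Series (fun n => lcoef (y N) N n * x ^ n))).
- intros N. apply PSeries_lcoef.
- apply (lp_lim_weighted c y _ (fun n => Rabs (x ^ n))); [exact H|intros; lra|].
  apply (ex_series_ext (fun n => Rabs (c n * x ^ n))); [intros; apply Rabs_mult|].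
  apply entire_ex_series_Rabs, H.
Qed.

Lemma lp_zero_free c y s :
  lp_approx c y -> 0 < s -> (forall x, 0 <= x <= s -> 0 < PSeries c x) ->
  exists N0, forall N, (N0 <= N)%nat -> forall j, (j < N)%nat -> y N j * s < 1.
Proof.
intros H Hs Hpos. destruct H as [Hc [Hb [Hl Hy]]].
destruct (continuity_ab_min (PSeries c) 0 s) as [m [Hm1 Hm2]]; [lra| |].
{ intros x _; apply entire_continuity, Hc. }
assert (mpos := Hpos m Hm2).
assert (L : is_lim_seq (fun N => Series (fun n => Rabs (lcoef (y N) N n - c n) * s ^ n)) (Series (fun n => 0 * s ^ n))).
{ apply (is_lim_seq_Series _ _ (fun n => 2 * Rabs (c n * s ^ n))).
  - intros N n. rewrite Rabs_mult, Rabs_Rabsolu, Rabs_mult, <- Rmult_assoc.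
    apply Rmult_le_compat_r; [apply Rabs_pos|].
    assert (A := Rabs_triang (lcoef (y N) N n) (- c n)). rewrite Rabs_Ropp in A.
    specialize (Hb N n). unfold Rminus. lra.
  - intros n. apply (is_lim_seq_scal_r _ (s ^ n) 0).
    replace (Finite 0) with (Rbar_abs (c n - c n)) by (simpl; rewrite Rminus_diag, Rabs_R0; reflexivity).
    apply (is_lim_seq_abs _ (c n - c n)), is_lim_seq_minus'; [apply Hl|apply is_lim_seq_const].
  - apply (ex_series_scal 2 (fun n => Rabs (c n * s ^ n))), entire_ex_series_Rabs, Hc. }
rewrite (Series_ext (fun n => 0 * s ^ n) (fun n => 0 * 0)) in L by (intros; ring).
rewrite Series_scal_l, Rmult_0_l in L.
apply is_lim_seq_spec in L. destruct (L (mkposreal _ mpos)) as [N0 HN]. exists N0.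
intros N hN j Hj. specialize (HN N hN). simpl in HN. rewrite Rminus_0_r in HN.
destruct (Rlt_dec (y N j * s) 1) as [A|A]; [exact A|exfalso].
assert (yj := Hy N j Hj).
set (x := / y N j). assert (x0 : 0 < x) by (apply Rinv_0_lt_compat, yj).
assert (xs : x <= s).
{ unfold x. apply (Rmult_le_reg_l (y N j)); [exact yj|]. rewrite Rinv_r; lra. }
assert (Z : PSeries (lcoef (y N) N) x = 0).
{ rewrite PSeries_lcoef. apply (lprod_root _ N j); [exact Hj|]. unfold x. field. lra. }
assert (D : Rabs (PSeries (lcoef (y N) N) x - PSeries c x) <=
            Series (fun n => Rabs (lcoef (y N) N n - c n) * s ^ n)).
{ unfold PSeries. rewrite <- Series_minus
    by (apply ex_pseries_R, entire_ex_pseries; auto using entire_lcoef).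
  assert (T : forall n, Rabs (lcoef (y N) N n * x ^ n - c n * x ^ n) <=
                        Rabs (lcoef (y N) N n - c n) * s ^ n).
  { intros n. rewrite <- Rmult_minus_distr_r, Rabs_mult.
    apply Rmult_le_compat_l; [apply Rabs_pos|].
    rewrite Rabs_pos_eq by (apply pow_le; lra). apply pow_incr; lra. }
  assert (X : ex_series (fun n => Rabs (lcoef (y N) N n - c n) * s ^ n)).
  { apply (ex_series_le_R _ (fun n => 2 * Rabs (c n * s ^ n))).
    - intros n. rewrite Rabs_mult, Rabs_Rabsolu, Rabs_mult, <- Rmult_assoc.
      apply Rmult_le_compat_r; [apply Rabs_pos|].
      assert (B := Rabs_triang (lcoef (y N) N n) (- c n)). rewrite Rabs_Ropp in B.
      specialize (Hb N n). unfold Rminus. lra.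
    - apply (ex_series_scal 2 (fun n => Rabs (c n * s ^ n))), entire_ex_series_Rabs, Hc. }
  eapply Rle_trans; [apply Series_Rabs|apply Series_le].
  - apply (ex_series_le_R _ (fun n => Rabs (lcoef (y N) N n - c n) * s ^ n)); [|exact X].
    intros n. rewrite Rabs_Rabsolu. apply T.
  - intros n; split; [apply Rabs_pos|apply T].
  - exact X. }
rewrite Z in D. specialize (Hm1 x ltac:(lra)). specialize (Hpos x ltac:(lra)).
rewrite Rminus_0_l, Rabs_Ropp, Rabs_pos_eq in D by lra.
apply Rabs_def2 in HN. lra.
Qed.

Fixpoint rsum (f : nat -> R) (N : nat) : R :=
  match N with O => 0 | S M => rsum f M + f M end.

Lemma rsum_ge_01 f N :
  (2 <= N)%nat -> (forall j, (j < N)%nat -> 0 <= f j) -> f 0%nat + f 1%nat <= rsum f N.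
Proof.
intros HN. destruct N as [|[|N]]; try lia. clear HN. induction N as [|N IH]; intros H.
- simpl. lra.
- specialize (IH ltac:(intros; apply H; lia)). assert (B := H (S (S N)) ltac:(lia)).
  simpl in *. lra.
Qed.

Definition psum (y : nat -> R) (k N : nat) : R := rsum (fun j => y j ^ k) N.

Lemma psum_diff y k N s :
  psum y k N - s * psum y (S k) N = rsum (fun j => y j ^ k * (1 - y j * s)) N.
Proof.
unfold psum. induction N as [|N IH]; simpl; [ring|]. rewrite <- IH. simpl. ring.
Qed.

Definition newton (c : nat -> R) (k : nat) : R :=
  match k with
  | 1 => - c 1%nat
  | 2 => c 1%nat ^ 2 - 2 * c 2%nat
  | _ => - c 1%nat ^ 3 + 3 * c 1%nat * c 2%nat - 3 * c 3%nat
  end.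

Lemma newton_lcoef y N k : (1 <= k <= 3)%nat -> newton (lcoef y N) k = psum y k N.
Proof.
intros Hk. unfold psum. induction N as [|N IH].
- destruct k as [|[|[|[|k]]]]; try lia; simpl; ring.
- assert (L0 := lcoef_0 y N).
  destruct k as [|[|[|[|k]]]]; try lia; simpl in IH |- *; rewrite <- IH, L0; ring.
Qed.

Lemma newton_lim c y k :
  (1 <= k <= 3)%nat -> lp_approx c y -> is_lim_seq (fun N => psum (y N) k N) (newton c k).
Proof.
intros Hk [_ [_ [Hl _]]].
apply (is_lim_seq_ext (fun N => newton (lcoef (y N) N) k)); [intros; apply newton_lcoef, Hk|].
assert (H1 := Hl 1%nat). assert (H2 := Hl 2%nat). assert (H3 := Hl 3%nat).
assert (K : forall a : R, is_lim_seq (fun _ => a) a) by (intros; apply is_lim_seq_const).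
assert (P : forall i (u : nat -> R) l, is_lim_seq u (Finite l) -> is_lim_seq (fun N => u N ^ i) (l ^ i)).
{ intros i u l Hu. induction i as [|i IH]; [apply K|]. exact (is_lim_seq_mult' _ _ _ _ Hu IH). }
destruct k as [|[|[|[|k]]]]; try lia; unfold newton.
- exact (proj1 (is_lim_seq_opp _ (Finite _)) H1).
- exact (is_lim_seq_minus' _ _ _ _ (P 2%nat _ _ H1) (is_lim_seq_mult' _ _ _ _ (K 2) H2)).
- apply is_lim_seq_minus'; [apply is_lim_seq_plus'|].
  + exact (proj1 (is_lim_seq_opp _ (Finite _)) (P 3%nat _ _ H1)).
  + exact (is_lim_seq_mult' _ _ _ _ (is_lim_seq_mult' _ _ _ _ (K 3) H1) H2).
  + exact (is_lim_seq_mult' _ _ _ _ (K 3) H3).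
Qed.

Lemma lprod_ge_exp y N x A :
  0 <= x -> A < 1 -> (forall j, (j < N)%nat -> 0 <= y j /\ y j * x <= A) ->
  exp (- (x * rsum y N / (1 - A))) <= lprod y N x.
Proof.
intros Hx HA. induction N as [|N IH]; intros H; simpl.
- replace (- (x * 0 / (1 - A))) with 0 by (field; lra). rewrite exp_0. lra.
- specialize (IH ltac:(intros; apply H; lia)). destruct (H N ltac:(lia)) as [H1 H2].
  replace (- (x * (rsum y N + y N) / (1 - A))) with
    (- (x * rsum y N / (1 - A)) + - (x * y N / (1 - A))) by (field; lra).
  rewrite exp_plus. apply Rmult_le_compat; [left; apply exp_pos|left; apply exp_pos|exact IH|].
  rewrite exp_Ropp.
  assert (B := exp_ineq1_le (x * y N / (1 - A))).
  assert (C : / (1 - y N * x) <= 1 + x * y N / (1 - A)).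
  { apply (Rmult_le_reg_r (1 - y N * x)); [lra|]. rewrite Rinv_l by lra.
    assert (0 <= x * y N) by nra.
    assert (x * y N <= x * y N / (1 - A) * (1 - y N * x)); [|lra].
    unfold Rdiv. rewrite Rmult_assoc. rewrite <- (Rmult_1_r (x * y N)) at 1.
    apply Rmult_le_compat_l; [assumption|].
    apply (Rmult_le_reg_l (1 - A)); [lra|]. rewrite <- Rmult_assoc, Rinv_r by lra. lra. }
  rewrite <- (Rinv_inv (1 - y N * x)). apply Rinv_le_contravar; [|lra].
  apply Rinv_0_lt_compat. lra.
Qed.

(** * Euler-Rayleigh inequalities *)

Lemma affine_limit_ge (a b k t : R) :
  0 < t -> (forall s, 0 < s < t -> k <= a - s * b) -> k <= a - t * b.
Proof.
intros Ht H. destruct (Rle_dec k (a - t * b)) as [A|A]; [exact A|exfalso].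
destruct (Rle_dec b 0) as [B|B].
- specialize (H (t / 2) ltac:(lra)). nra.
- set (d := k - (a - t * b)). assert (0 < d) by (unfold d; lra).
  set (s := Rmax (t / 2) (t - d / (2 * b))).
  assert (0 < d / (2 * b)) by (apply Rdiv_lt_0_compat; lra).
  assert (s < t) by (apply Rmax_lub_lt; lra).
  assert (t / 2 <= s) by apply Rmax_l. assert (t - d / (2 * b) <= s) by apply Rmax_r.
  specialize (H s ltac:(lra)).
  assert ((t - s) * b <= d / 2).
  { replace (d / 2) with (d / (2 * b) * b) by (field; lra).
    apply Rmult_le_compat_r; lra. }
  unfold d in *. nra.
Qed.

(* The second root [v N 1], bounded away from [0] and from [1/t], is what makes these bounds strict in the limit. *)
Lemma euler_rayleigh_upper c v b a t k :
  (1 <= k <= 2)%nat -> lp_approx c v -> 0 < b -> 0 < t -> a * t < 1 ->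
  (forall s, 0 <= s < t -> 0 < PSeries c s) ->
  (forall N, (2 <= N)%nat -> b <= v N 1%nat) ->
  (exists N0, forall N, (N0 <= N)%nat -> v N 1%nat <= a) ->
  t * newton c (S k) < newton c k.
Proof.
intros Hk H Hb Ht Ha Hpos Hv1 [N1 Hva].
assert (K : 0 < b ^ k * (1 - a * t)) by (apply Rmult_lt_0_compat; [apply pow_lt, Hb|lra]).
enough (b ^ k * (1 - a * t) <= newton c k - t * newton c (S k)) by lra.
apply affine_limit_ge; [exact Ht|]. intros s Hs.
destruct (lp_zero_free c v s H) as [N0 HN0]; [lra|intros; apply Hpos; lra|].
apply (is_lim_seq_le_loc (fun _ => b ^ k * (1 - a * t))
         (fun N => psum (v N) k N - s * psum (v N) (S k) N)
         (Finite _) (Finite (newton c k - s * newton c (S k)))).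
- exists (2 + N0 + N1)%nat. intros N hN.
  specialize (HN0 N ltac:(lia)). specialize (Hv1 N ltac:(lia)). specialize (Hva N ltac:(lia)).
  assert (pos := proj2 (proj2 (proj2 H)) N).
  assert (T : forall j, (j < N)%nat -> 0 <= v N j ^ k * (1 - v N j * s)).
  { intros j Hj. specialize (HN0 j Hj). specialize (pos j Hj).
    apply Rmult_le_pos; [apply pow_le|]; lra. }
  assert (G := rsum_ge_01 _ N ltac:(lia) T).
  rewrite psum_diff. specialize (T 0%nat ltac:(lia)).
  assert (b ^ k * (1 - a * t) <= v N 1%nat ^ k * (1 - v N 1%nat * s)); [|lra].
  apply Rmult_le_compat; [apply pow_le; lra|lra|apply pow_incr; lra|nra].
- apply is_lim_seq_const.
- apply is_lim_seq_minus'; [apply newton_lim; (lia || exact H)|].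
  apply is_lim_seq_mult'; [apply is_lim_seq_const|apply newton_lim; (lia || exact H)].
Qed.

Lemma euler_rayleigh_lower c v b t k :
  (1 <= k <= 2)%nat -> lp_approx c v -> 0 < b -> 0 < t -> PSeries c t = 0 ->
  (forall N, (2 <= N)%nat -> b <= v N 1%nat) ->
  (forall N j, (j < N)%nat -> v N j <= v N 0%nat) ->
  / t ^ k < newton c k.
Proof.
intros Hk H Hb Ht Hz Hv1 Hv0.
destruct (Rlt_dec (/ t ^ k) (newton c k)) as [A|A]; [exact A|exfalso].
set (d := (b * t) ^ k). assert (dpos : 0 < d) by (apply pow_lt, Rmult_lt_0_compat; assumption).
assert (tk : 0 < t ^ k) by (apply pow_lt, Ht).
assert (bk : 0 < b ^ k / 2) by (assert (0 < b ^ k) by (apply pow_lt, Hb); lra).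
assert (L := newton_lim c v k ltac:(lia) H). apply is_lim_seq_spec in L.
destruct (L (mkposreal _ bk)) as [N0 HN0]. cbn [pos] in HN0.
assert (L1 := newton_lim c v 1 ltac:(lia) H). apply is_lim_seq_spec in L1.
destruct (L1 (mkposreal _ Rlt_0_1)) as [N1 HN1]. cbn [pos] in HN1.
assert (L2 := lp_lim c v t H). rewrite Hz in L2. apply is_lim_seq_spec in L2.
set (e := exp (- (t * (newton c 1 + 1) / (d / 4)))).
assert (epos : 0 < e) by apply exp_pos.
destruct (L2 (mkposreal _ epos)) as [N2 HN2]. simpl in HN2.
set (N := (2 + N0 + N1 + N2)%nat).
specialize (HN0 N ltac:(lia)). specialize (HN1 N ltac:(lia)). specialize (HN2 N ltac:(lia)).
specialize (Hv1 N ltac:(lia)). specialize (Hv0 N).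
assert (pos := proj2 (proj2 (proj2 H)) N).
assert (G : v N 0%nat ^ k + v N 1%nat ^ k <= psum (v N) k N).
{ apply (rsum_ge_01 (fun j => v N j ^ k)); [lia|]. intros j Hj. apply pow_le. specialize (pos j Hj). lra. }
assert (B1 : b ^ k <= v N 1%nat ^ k) by (apply pow_incr; lra).
apply Rabs_def2 in HN0, HN1, HN2.
assert (P0 := pos 0%nat ltac:(lia)).
set (w := v N 0%nat * t). assert (wpos : 0 < w) by (apply Rmult_lt_0_compat; assumption).
assert (W : w ^ k < 1 - d / 2).
{ unfold w, d. rewrite !Rpow_mult_distr.
  assert (v N 0%nat ^ k < / t ^ k - b ^ k / 2) by lra.
  replace (1 - b ^ k * t ^ k / 2) with ((/ t ^ k - b ^ k / 2) * t ^ k) by (field; lra).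
  apply Rmult_lt_compat_r; assumption. }
assert (W1 : w <= 1 - d / 4).
{ assert (0 < w ^ k) by (apply pow_lt, wpos). 
  destruct k as [|[|[|k]]]; try lia; clearbody d w; cbn [pow] in *; nra. }
assert (E : exp (- (t * rsum (v N) N / (1 - (1 - d / 4)))) <= lprod (v N) N t).
{ apply lprod_ge_exp; [lra|lra|]. intros j Hj. specialize (Hv0 j Hj). specialize (pos j Hj).
  split; [lra|]. unfold w in W1. nra. }
assert (S1 : forall M, rsum (v N) M = psum (v N) 1 M).
{ unfold psum. intros M. induction M as [|M IH]; cbn [rsum]; [reflexivity|]. rewrite IH. ring. }
rewrite S1 in E.
assert (e <= exp (- (t * psum (v N) 1 N / (1 - (1 - d / 4))))); [|lra].
assert (X : - (t * (newton c 1 + 1) / (d / 4)) <= - (t * psum (v N) 1 N / (1 - (1 - d / 4)))).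
{ apply Ropp_le_contravar. replace (1 - (1 - d / 4)) with (d / 4) by ring.
  apply Rmult_le_compat_r; [left; apply Rinv_0_lt_compat; lra|].
  apply Rmult_le_compat_l; lra. }
destruct X as [X|X]; [left; apply exp_increasing, X | right; unfold e; rewrite X; reflexivity].
Qed.

Lemma newton_pos c v b k :
  (1 <= k <= 3)%nat -> lp_approx c v -> 0 < b ->
  (forall N, (2 <= N)%nat -> b <= v N 1%nat) -> 0 < newton c k.
Proof.
intros Hk H Hb Hv1. assert (bk : 0 < b ^ k) by (apply pow_lt, Hb).
enough (b ^ k <= newton c k) by lra.
apply (is_lim_seq_le_loc (fun _ => b ^ k) (fun N => psum (v N) k N) (Finite _) (Finite _));
  [|apply is_lim_seq_const|apply newton_lim; assumption].
exists 2%nat. intros N HN. specialize (Hv1 N HN).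
assert (pos := proj2 (proj2 (proj2 H)) N).
assert (T : forall j, (j < N)%nat -> 0 <= v N j ^ k)
  by (intros j Hj; apply pow_le; specialize (pos j Hj); lra).
assert (G := rsum_ge_01 _ N HN T). specialize (T 0%nat ltac:(lia)).
assert (b ^ k <= v N 1%nat ^ k) by (apply pow_incr; lra). unfold psum. lra.
Qed.

Lemma countable_choice (A : Type) (P : nat -> A -> Prop) :
  (forall n, exists a, P n a) -> exists f : nat -> A, forall n, P n (f n).
Proof.
intros H. exists (fun n => proj1_sig (constructive_indefinite_description _ (H n))).
intros n. apply proj2_sig.
Qed.

Lemma qcoef_lp_approx b q :
  0 < q < 1 -> 0 < b < 1 ->
  exists y v, lp_approx (qcoef b q) y /\ lp_approx (dcoef (qcoef b q)) v /\
    (forall N, (2 <= N)%nat -> q ^ 2 <= v N 1%nat <= y N 0%nat) /\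
    (forall N j, (j < N)%nat -> v N j <= v N 0%nat).
Proof.
intros Hq Hb.
assert (H : forall N, exists p : (nat -> R) * (nat -> R),
  (forall n, qapprox b q N n = lcoef (fst p) N n) /\
  (forall n, dcoef (qapprox b q N) n = lcoef (snd p) N n) /\
  (forall j, (j < N)%nat -> 0 < fst p j) /\ (forall j, (j < N)%nat -> 0 < snd p j) /\
  ((2 <= N)%nat -> q ^ 2 <= snd p 1%nat <= fst p 0%nat) /\
  (forall j, (j < N)%nat -> snd p j <= snd p 0%nat)).
{ intros N. destruct (qapprox_roots b q N Hq Hb) as [y [Sy [Ly Ey]]].
  destruct (lcoef_deriv_roots q y N Hq Sy) as [v [V1 [V2 V3]]].
  assert (pos := proj1 Sy). exists (y, v); simpl fst; simpl snd.
  split; [exact Ey|split; [|split; [exact pos|split; [|split]]]].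
  - intros n. rewrite <- V3. unfold dcoef, PS_derive, PS_incr_1. rewrite Ey. reflexivity.
  - intros j Hj. specialize (V1 j Hj). specialize (pos j Hj). lra.
  - intros HN. specialize (Ly 1%nat ltac:(lia)). specialize (V1 1%nat ltac:(lia)).
    specialize (V2 0%nat ltac:(lia)). lra.
  - intros [|j] Hj; [lra|]. specialize (V2 j Hj). specialize (V1 0%nat ltac:(lia)).
    assert (A := qsep_le q y N 0 j Hq Sy ltac:(lia)). lra. }
destruct (countable_choice _ _ H) as [p Hp].
exists (fun N => fst (p N)), (fun N => snd (p N)).
assert (Ent := entire_qcoef b q Hq Hb).
split; [|split; [|split; [intros; apply Hp; assumption | intros; apply Hp; assumption]]].
- split; [exact Ent|split; [|split]].
  + intros N n. destruct (Hp N) as [E _]. rewrite <- E. apply qapprox_bound; assumption.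
  + intros n. apply (is_lim_seq_ext (fun N => qapprox b q N n)); [intros; apply Hp|].
    apply qapprox_lim, Hq.
  + intros N j Hj. apply Hp, Hj.
- split; [apply entire_dcoef, Ent|split; [|split]].
  + intros N n. destruct (Hp N) as [_ [E _]]. rewrite <- E.
    unfold dcoef, PS_derive, PS_incr_1. rewrite !Rabs_mult.
    apply Rmult_le_compat_l; [apply Rabs_pos|]. apply qapprox_bound; assumption.
  + intros n. apply (is_lim_seq_ext (fun N => INR (S n) * qapprox b q N n)); [intros; apply Hp|].
    apply (is_lim_seq_scal_l _ (INR (S n)) (qcoef b q n)), qapprox_lim, Hq.
  + intros N j Hj. apply Hp, Hj.
Qed.

Lemma dcoef_first_zero b q :
  0 < q < 1 -> 0 < b < 1 ->
  exists t, 0 < t /\ PSeries (dcoef (qcoef b q)) t = 0 /\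
    (forall s, 0 <= s < t -> 0 < PSeries (dcoef (qcoef b q)) s) /\
    (forall s, 0 <= s <= t -> 0 < PSeries (qcoef b q) s) /\
    (forall k, (1 <= k <= 3)%nat -> 0 < newton (dcoef (qcoef b q)) k) /\
    (forall k, (1 <= k <= 2)%nat ->
      / t ^ k < newton (dcoef (qcoef b q)) k /\
      t * newton (dcoef (qcoef b q)) (S k) < newton (dcoef (qcoef b q)) k).
Proof.
intros Hq Hb. destruct (qcoef_lp_approx b q Hq Hb) as [y [v [Hy [Hv [Hvy Hv0]]]]].
assert (q2 : 0 < q ^ 2) by (apply pow_lt; lra).
set (c := qcoef b q) in *.
assert (Ec : entire c) by apply Hy. assert (Ed : entire (dcoef c)) by apply Hv.
assert (c0 : c 0%nat = 1) by (unfold c, qcoef; simpl; field).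
assert (Z : exists x, 0 < x /\ PSeries (dcoef c) x <= 0).
{ destruct (classic (exists x, 0 < x /\ PSeries (dcoef c) x <= 0)) as [Z|Z]; [exact Z|exfalso].
  assert (i2 : 0 < / q ^ 2) by (apply Rinv_0_lt_compat, q2).
  destruct (lp_zero_free _ v (/ q ^ 2) Hv i2) as [N0 HN0].
  - intros x [[Hx|<-] _].
    + destruct (Rlt_dec 0 (PSeries (dcoef c) x)) as [A|A]; [exact A|].
      exfalso; apply Z; exists x; lra.
    + rewrite PSeries_0. unfold dcoef, PS_derive, PS_incr_1. rewrite c0. simpl. lra.
  - specialize (HN0 (2 + N0)%nat ltac:(lia) 1%nat ltac:(lia)).
    destruct (Hvy (2 + N0)%nat ltac:(lia)) as [A _].
    apply (Rmult_le_compat_r (/ q ^ 2)) in A; [|lra]. rewrite Rinv_r in A by lra. lra. }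
destruct Z as [x0 [Hx0 Hz0]].
destruct (first_zero (PSeries (dcoef c)) x0) as [t [[Ht _] [Hz Hpos]]].
{ apply entire_continuity, Ed. }
{ rewrite PSeries_0. unfold dcoef, PS_derive, PS_incr_1. rewrite c0. simpl. lra. }
{ exact Hx0. } { exact Hz0. }
assert (gpos : forall s, 0 <= s <= t -> 0 < PSeries c s).
{ intros s [[Hs|<-] Hst]; [|rewrite PSeries_0, c0; lra].
  destruct (MVT_cor2 (fun x => x * PSeries c x) (PSeries (dcoef c)) 0 s Hs) as [z [E Hz']].
  { intros z _. apply is_derive_Reals, is_derive_mul_PSeries, Ec. }
  assert (0 < PSeries (dcoef c) z) by (apply Hpos; lra).
  rewrite Rmult_0_l, !Rminus_0_r in E. rewrite Rmult_comm in E.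
  apply Rmult_eq_reg_r in E; lra. }
exists t. split; [exact Ht|split; [exact Hz|split; [exact Hpos|split; [exact gpos|split]]]].
{ intros k Hk. apply (newton_pos _ v (q ^ 2)); try assumption. intros; apply Hvy; assumption. }
intros k Hk. split.
- apply (euler_rayleigh_lower _ v (q ^ 2)); try assumption. intros; apply Hvy; assumption.
- destruct (continuity_pos_near (PSeries c) t) as [d [Hd Hn]].
  { apply entire_continuity, Ec. } { apply gpos; lra. }
  set (s := t + d / 2).
  destruct (lp_zero_free c y s Hy) as [N0 HN0]; [unfold s; lra| |].
  { intros x Hx. destruct (Rle_dec x t) as [A|A]; [apply gpos; lra|].
    apply Hn, Rabs_def1; unfold s in Hx; lra. }
  apply (euler_rayleigh_upper _ v (q ^ 2) (/ s)); try assumption.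
  + apply (Rmult_lt_reg_l s); [unfold s; lra|].
    rewrite <- Rmult_assoc, Rinv_r by (unfold s; lra). unfold s; lra.
  + intros; apply Hvy; assumption.
  + exists (2 + N0)%nat. intros N HN. specialize (HN0 N ltac:(lia) 0%nat ltac:(lia)).
    destruct (Hvy N ltac:(lia)) as [_ A]. apply (Rmult_le_reg_r s); [unfold s; lra|].
    rewrite Rinv_l by (unfold s; lra). assert (0 < s) by (unfold s; lra). nra.
Qed.

(** * Power series with real coefficients at complex points *)

Lemma Rabs_Im_le (z : C) : Rabs (Im z) <= Cmod z.
Proof. eapply Rle_trans; [apply Rmax_r|apply Rmax_Cmod]. Qed.

Lemma Cmod_pow_n (z : C) n : Cmod (pow_n z n) = Cmod z ^ n.
Proof.
induction n as [|n IH]; [apply Cmod_1|].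
change (Cmod (z * pow_n z n) = Cmod z * Cmod z ^ n). rewrite Cmod_mult, IH. reflexivity.
Qed.

Definition CPSeries (c : nat -> R) (z : C) : C :=
  (Series (fun n => c n * Re (pow_n z n)), Series (fun n => c n * Im (pow_n z n))).

Lemma ex_series_Re (c : nat -> R) z : entire c -> ex_series (fun n => c n * Re (pow_n z n)).
Proof.
intros H. apply (ex_series_le_R _ (fun n => Rabs (c n * Cmod z ^ n))).
- intros n. rewrite !Rabs_mult, <- Cmod_pow_n, (Rabs_pos_eq (Cmod _)) by apply Cmod_ge_0.
  apply Rmult_le_compat_l; [apply Rabs_pos|apply re_le_Cmod].
- apply entire_ex_series_Rabs, H.
Qed.

Lemma ex_series_Im (c : nat -> R) z : entire c -> ex_series (fun n => c n * Im (pow_n z n)).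
Proof.
intros H. apply (ex_series_le_R _ (fun n => Rabs (c n * Cmod z ^ n))).
- intros n. rewrite !Rabs_mult, <- Cmod_pow_n, (Rabs_pos_eq (Cmod _)) by apply Cmod_ge_0.
  apply Rmult_le_compat_l; [apply Rabs_pos|apply Rabs_Im_le].
- apply entire_ex_series_Rabs, H.
Qed.

Lemma Series_Re_S (c : nat -> R) z : entire c ->
  Series (fun n => c n * Re (pow_n z (S n))) = Re (z * CPSeries c z).
Proof.
intros H. simpl. unfold CPSeries; simpl. rewrite <- !Series_scal_l, <- Series_minus.
- apply Series_ext; intros n. 
  change (c n * (Re z * Re (pow_n z n) - Im z * Im (pow_n z n)) =
    fst z * (c n * Re (pow_n z n)) - snd z * (c n * Im (pow_n z n))). unfold Re at 1, Im at 1. ring.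
- apply (ex_series_scal (fst z) (fun n => c n * Re (pow_n z n))), ex_series_Re, H.
- apply (ex_series_scal (snd z) (fun n => c n * Im (pow_n z n))), ex_series_Im, H.
Qed.

Lemma Series_Im_S (c : nat -> R) z : entire c ->
  Series (fun n => c n * Im (pow_n z (S n))) = Im (z * CPSeries c z).
Proof.
intros H. simpl. unfold CPSeries; simpl. rewrite <- !Series_scal_l, <- Series_plus.
- apply Series_ext; intros n.
  change (c n * (Re z * Im (pow_n z n) + Im z * Re (pow_n z n)) =
    fst z * (c n * Im (pow_n z n)) + snd z * (c n * Re (pow_n z n))). unfold Re at 1, Im at 2. ring.
- apply (ex_series_scal (fst z) (fun n => c n * Im (pow_n z n))), ex_series_Im, H.
- apply (ex_series_scal (snd z) (fun n => c n * Re (pow_n z n))), ex_series_Re, H.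
Qed.

Lemma CPSeries_incr_1 (c : nat -> R) z :
  entire c -> CPSeries (PS_incr_1 c) z = (z * CPSeries c z)%C.
Proof.
intros H. 
assert (H' : entire (PS_incr_1 c)) by (unfold entire; rewrite CV_radius_incr_1; exact H).
apply injective_projections.
- change (Series (fun n => PS_incr_1 c n * Re (pow_n z n)) = Re (z * CPSeries c z)).
  rewrite Series_incr_1 by (apply ex_series_Re, H'). rewrite <- Series_Re_S by exact H.
  change (0 * 1 + Series (fun n => c n * Re (pow_n z (S n))) = Series (fun n => c n * Re (pow_n z (S n)))). ring.
- change (Series (fun n => PS_incr_1 c n * Im (pow_n z n)) = Im (z * CPSeries c z)).
  rewrite Series_incr_1 by (apply ex_series_Im, H'). rewrite <- Series_Im_S by exact H.
  change (0 * 0 + Series (fun n => c n * Im (pow_n z (S n))) = Series (fun n => c n * Im (pow_n z (S n)))). ring.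
Qed.

Lemma CPSeries_ext (c d : nat -> R) z : (forall n, c n = d n) -> CPSeries c z = CPSeries d z.
Proof.
intros H. unfold CPSeries. f_equal; apply Series_ext; intros n; rewrite H; reflexivity.
Qed.

Lemma entire_sub_scal (c d : nat -> R) k :
  entire c -> entire d -> entire (fun n => c n - k * d n).
Proof.
intros Hc Hd. unfold entire.
rewrite (CV_radius_ext _ (PS_plus c (PS_scal (- k) d))).
- assert (Hs : CV_radius (PS_scal (- k) d) = p_infty).
  { destruct (Req_dec k 0) as [->|E].
    - apply (entire_finite _ 0). intros n _. unfold PS_scal, scal; simpl; unfold mult; simpl. ring.
    - rewrite CV_radius_scal by lra. exact Hd. }
  assert (A := CV_radius_plus c (PS_scal (- k) d)). rewrite Hc, Hs in A.
  destruct (CV_radius (PS_plus c (PS_scal (- k) d))); [destruct A|reflexivity|destruct A].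
- intros n. unfold PS_plus, PS_scal, plus, scal; simpl; unfold mult; simpl. ring.
Qed.

Lemma CPSeries_sub_scal (c d : nat -> R) k z : entire c -> entire d ->
  CPSeries (fun n => c n - k * d n) z = (CPSeries c z - k * CPSeries d z)%C.
Proof.
intros Hc Hd. unfold CPSeries. apply injective_projections; simpl.
- rewrite (Series_ext _ (fun n => c n * Re (pow_n z n) - k * (d n * Re (pow_n z n)))) by (intros; ring).
  rewrite Series_minus, Series_scal_l; [ring|apply ex_series_Re, Hc|].
  apply (ex_series_scal k (fun n => d n * Re (pow_n z n))), ex_series_Re, Hd.
- rewrite (Series_ext _ (fun n => c n * Im (pow_n z n) - k * (d n * Im (pow_n z n)))) by (intros; ring).
  rewrite Series_minus, Series_scal_l; [ring|apply ex_series_Im, Hc|].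
  apply (ex_series_scal k (fun n => d n * Im (pow_n z n))), ex_series_Im, Hd.
Qed.

Lemma mul_lin_incr (c : nat -> R) y n : mul_lin c y n = c n - y * PS_incr_1 c n.
Proof. destruct n; simpl; [change zero with 0|]; ring. Qed.

Lemma CPSeries_mul_lin (c : nat -> R) y z :
  entire c -> CPSeries (mul_lin c y) z = ((1 - y * z) * CPSeries c z)%C.
Proof.
intros H. rewrite (CPSeries_ext _ _ z (mul_lin_incr c y)).
rewrite CPSeries_sub_scal, CPSeries_incr_1 by (unfold entire; rewrite ?CV_radius_incr_1; exact H).
ring.
Qed.

Lemma CPSeries_dcoef_mul_lin (c : nat -> R) y z : entire c ->
  CPSeries (dcoef (mul_lin c y)) z =
  ((1 - y * z) * CPSeries (dcoef c) z - y * z * CPSeries c z)%C.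
Proof.
intros H. assert (Hd := entire_dcoef c H).
assert (Hm : entire (mul_lin (dcoef c) y)).
{ unfold entire. rewrite (CV_radius_ext _ _ (mul_lin_incr _ _)).
  apply entire_sub_scal; unfold entire; rewrite ?CV_radius_incr_1; exact Hd. }
rewrite (CPSeries_ext _ (fun n => mul_lin (dcoef c) y n - y * PS_incr_1 c n)).
- rewrite CPSeries_sub_scal, CPSeries_incr_1, CPSeries_mul_lin
    by (unfold entire; rewrite ?CV_radius_incr_1; assumption). ring.
- intros [|n]; unfold dcoef, PS_derive, PS_incr_1, mul_lin.
  + change zero with 0. ring.
  + rewrite (S_INR (S n)). ring.
Qed.

Lemma Re_quotient_step (a b u : C) (ga pb r : R) :
  Cmod u = r -> r < 1 -> 0 < pb ->
  ga * Cmod b ^ 2 <= pb * Re (a * Cconj b) ->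
  ((1 - r) * ga - r * pb) * Cmod ((1 - u) * b) ^ 2 <=
  ((1 - r) * pb) * Re (((1 - u) * a - u * b) * Cconj ((1 - u) * b)).
Proof.
intros Hu Hr Hp H. assert (r0 : 0 <= r) by (rewrite <- Hu; apply Cmod_ge_0).
assert (U := Cmod2_alt u). rewrite Hu in U. rewrite Cmod2_alt in H. rewrite Cmod2_alt.
assert (A : Re u <= r) by (rewrite <- Hu; eapply Rle_trans; [apply Rle_abs|apply re_le_Cmod]).
destruct a as [a1 a2], b as [b1 b2], u as [u1 u2]. simpl in *.
clear Hu.
set (s := u1 ^ 2 + u2 ^ 2). set (B := b1 ^ 2 + b2 ^ 2). set (D := 1 - 2 * u1 + s).
assert (sr : s = r ^ 2) by (unfold s; lra).
assert (B0 : 0 <= B) by (unfold B; nra).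
assert (D0 : 0 <= D) by (unfold D, s; nra).
assert (H2 : 0 <= pb * B * (r * D - (1 - r) * (u1 - s))).
{ apply Rmult_le_pos; [apply Rmult_le_pos; lra|].
  replace (r * D - (1 - r) * (u1 - s)) with ((1 + r) * (r - u1)) by (unfold D; rewrite sr; ring). nra. }
assert (H1 : 0 <= (1 - r) * D * (pb * (a1 * b1 - a2 * - b2) - ga * B)).
{ apply Rmult_le_pos; [apply Rmult_le_pos; lra|]. unfold B; simpl; lra. }
match goal with |- ?L <= ?R => assert (E : R - L = (1 - r) * D * (pb * (a1 * b1 - a2 * - b2) - ga * B) +
  pb * B * (r * D - (1 - r) * (u1 - s))) by (unfold D, B, s; ring) end.
lra.
Qed.

Lemma CPSeries_const (c : nat -> R) z : (forall n, c (S n) = 0) -> CPSeries c z = RtoC (c 0%nat).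
Proof.
intros H.
assert (K : forall u : nat -> R, Series (fun n => c n * u n) = c 0%nat * u 0%nat).
{ intros u. rewrite (Series_ext _ (fun n => c n * u n * 1 ^ n)) by (intros; rewrite pow1; ring).
  change (PSeries (fun n => c n * u n) 1 = c 0%nat * u 0%nat).
  rewrite (PSeries_finite _ 0); [simpl; ring|]. intros [|n] Hn; [lia|]. rewrite H. ring. }
unfold CPSeries. rewrite !K. simpl. unfold RtoC. f_equal; ring.
Qed.

Lemma pow_n_RtoC (x : R) n : pow_n (RtoC x) n = RtoC (x ^ n).
Proof.
induction n as [|n IH]; [reflexivity|].
change (RtoC x * pow_n (RtoC x) n = RtoC (x * x ^ n))%C. rewrite IH, RtoC_mult. reflexivity.
Qed.

Lemma CPSeries_RtoC (c : nat -> R) x : CPSeries c (RtoC x) = RtoC (PSeries c x).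
Proof.
apply injective_projections.
- apply Series_ext; intros n. rewrite pow_n_RtoC. reflexivity.
- change (Series (fun n => c n * Im (pow_n (RtoC x) n)) = 0).
  rewrite (Series_ext _ (fun n => 0 * 0)), Series_scal_l; [ring|].
  intros n. rewrite pow_n_RtoC. simpl. ring.
Qed.

Lemma PSeries_dcoef_mul_lin (c : nat -> R) y x : entire c ->
  PSeries (dcoef (mul_lin c y)) x =
  (1 - y * x) * PSeries (dcoef c) x - y * x * PSeries c x.
Proof.
intros H. apply RtoC_inj. rewrite RtoC_minus, !RtoC_mult, RtoC_minus, RtoC_mult, <- !CPSeries_RtoC.
apply CPSeries_dcoef_mul_lin, H.
Qed.

Lemma lcoef_Re_quotient y N z :
  (forall j, (j < N)%nat -> 0 < y j /\ y j * Cmod z < 1) ->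
  0 < lprod y N (Cmod z) <= Cmod (CPSeries (lcoef y N) z) /\
  PSeries (dcoef (lcoef y N)) (Cmod z) * Cmod (CPSeries (lcoef y N) z) ^ 2 <=
  lprod y N (Cmod z) * Re (CPSeries (dcoef (lcoef y N)) z * Cconj (CPSeries (lcoef y N) z)).
Proof.
induction N as [|N IH]; intros H.
- rewrite (CPSeries_const (lcoef y 0)) by reflexivity.
  assert (D : forall n, dcoef (lcoef y 0) (S n) = 0)
    by (intros; unfold dcoef, PS_derive, PS_incr_1; simpl; ring).
  rewrite (CPSeries_const (dcoef (lcoef y 0))), (PSeries_finite _ 0)
    by (exact D || (intros [|n] Hn; [lia|apply D])).
  rewrite Cmod_R. simpl. rewrite Rabs_R1. split; [lra|].
  unfold dcoef, PS_derive, PS_incr_1; simpl. lra.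
- destruct IH as [[P1 P2] P3]; [intros; apply H; lia|].
  destruct (H N ltac:(lia)) as [yp yr].
  assert (Hu : Cmod (y N * z) = y N * Cmod z).
  { rewrite Cmod_mult, Cmod_R, Rabs_pos_eq by lra. reflexivity. }
  cbn [lcoef lprod].
  rewrite CPSeries_dcoef_mul_lin, CPSeries_mul_lin, PSeries_dcoef_mul_lin, PSeries_lcoef by apply entire_lcoef.
  set (u := (y N * z)%C) in *. clearbody u. rewrite <- Hu in *.
  split.
  + split; [nra|]. rewrite Cmod_mult, Rmult_comm.
    apply Rmult_le_compat; [lra|lra| |exact P2].
    assert (T := Cmod_triangle (1 - u) u). replace (1 - u + u)%C with (RtoC 1) in T by ring.
    rewrite Cmod_1 in T. lra.
  + rewrite (Rmult_comm (lprod _ _ _)). apply Re_quotient_step; try assumption; reflexivity.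
Qed.

Lemma lp_lim_dcoef c y (w : nat -> R) r :
  lp_approx c y -> (forall n, Rabs (w n) <= r ^ n) ->
  is_lim_seq (fun N => Series (fun n => dcoef (lcoef (y N) N) n * w n))
    (Series (fun n => dcoef c n * w n)).
Proof.
intros H Hw.
rewrite (Series_ext (fun n => dcoef c n * w n) (fun n => c n * (INR (S n) * w n)))
  by (intros; unfold dcoef, PS_derive, PS_incr_1; ring).
apply (is_lim_seq_ext (fun N => Series (fun n => lcoef (y N) N n * (INR (S n) * w n)))).
- intros N. apply Series_ext; intros n. unfold dcoef, PS_derive, PS_incr_1. ring.
- apply (lp_lim_weighted c y _ (fun n => INR (S n) * Rabs (r ^ n))); [exact H| |].
  + intros n. rewrite Rabs_mult, (Rabs_pos_eq (INR _)) by apply pos_INR.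
    apply Rmult_le_compat_l; [apply pos_INR|]. eapply Rle_trans; [apply Hw|apply Rle_abs].
  + apply (ex_series_ext (fun n => Rabs (dcoef c n * r ^ n))).
    * intros n. unfold dcoef, PS_derive, PS_incr_1.
      rewrite !Rabs_mult, (Rabs_pos_eq (INR _)), (Rmult_comm (INR _)) by apply pos_INR.
      apply Rmult_assoc.
    * apply entire_ex_series_Rabs, entire_dcoef, H.
Qed.

Lemma lp_lim_bounded c y (w : nat -> R) r :
  lp_approx c y -> (forall n, Rabs (w n) <= r ^ n) ->
  is_lim_seq (fun N => Series (fun n => lcoef (y N) N n * w n)) (Series (fun n => c n * w n)).
Proof.
intros H Hw. apply (lp_lim_weighted c y _ (fun n => Rabs (r ^ n))); [exact H| |].
- intros n. eapply Rle_trans; [apply Hw|apply Rle_abs].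
- apply (ex_series_ext (fun n => Rabs (c n * r ^ n))); [intros; apply Rabs_mult|].
  apply entire_ex_series_Rabs, H.
Qed.

Lemma lp_Re_quotient_pos c y z :
  lp_approx c y -> 0 < Cmod z ->
  (forall s, 0 <= s <= Cmod z -> 0 < PSeries c s) ->
  0 < PSeries (dcoef c) (Cmod z) ->
  0 < Re (CPSeries (dcoef c) z * Cconj (CPSeries c z)).
Proof.
intros H Hz Hpos Hd.
destruct (lp_zero_free c y (Cmod z) H Hz Hpos) as [N0 HN0].
assert (bR : forall n, Rabs (Re (pow_n z n)) <= Cmod z ^ n)
  by (intros; rewrite <- Cmod_pow_n; apply re_le_Cmod).
assert (bI : forall n, Rabs (Im (pow_n z n)) <= Cmod z ^ n)
  by (intros; rewrite <- Cmod_pow_n; apply Rabs_Im_le).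
assert (bx : forall n, Rabs (Cmod z ^ n) <= Cmod z ^ n)
  by (intros; rewrite Rabs_pos_eq; [lra|apply pow_le, Cmod_ge_0]).
assert (Lp := lp_lim c y (Cmod z) H).
assert (Lg := lp_lim_dcoef c y _ _ H bx).
assert (LA1 := lp_lim_dcoef c y _ _ H bR). assert (LA2 := lp_lim_dcoef c y _ _ H bI).
assert (LB1 := lp_lim_bounded c y _ _ H bR). assert (LB2 := lp_lim_bounded c y _ _ H bI).
assert (LBB := is_lim_seq_plus' _ _ _ _ (is_lim_seq_mult' _ _ _ _ LB1 LB1) (is_lim_seq_mult' _ _ _ _ LB2 LB2)).
assert (LAB := is_lim_seq_plus' _ _ _ _ (is_lim_seq_mult' _ _ _ _ LA1 LB1) (is_lim_seq_mult' _ _ _ _ LA2 LB2)).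
assert (ev : forall N, (N0 <= N)%nat -> forall j, (j < N)%nat -> 0 < y N j /\ y N j * Cmod z < 1).
{ intros N HN j Hj. split; [apply H, Hj|apply HN0; assumption]. }
assert (I1 : PSeries c (Cmod z) * PSeries c (Cmod z) <= Cmod (CPSeries c z) ^ 2).
{ rewrite Cmod2_alt. simpl. rewrite !Rmult_1_r.
  refine (is_lim_seq_le_loc _ _ _ _ _ (is_lim_seq_mult' _ _ _ _ Lp Lp) LBB).
  exists N0. intros N HN. destruct (lcoef_Re_quotient (y N) N z (ev N HN)) as [P _].
  assert (Q := Cmod2_alt (CPSeries (lcoef (y N) N) z)). simpl in Q. rewrite !Rmult_1_r in Q.
  rewrite <- Q. apply Rmult_le_compat; lra. }
assert (I2 : PSeries (dcoef c) (Cmod z) * Cmod (CPSeries c z) ^ 2 <=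
  PSeries c (Cmod z) * Re (CPSeries (dcoef c) z * Cconj (CPSeries c z))).
{ rewrite Cmod2_alt. simpl. rewrite !Rmult_1_r.
  refine (Rle_trans _ _ _ (is_lim_seq_le_loc _ _ _ _ _ (is_lim_seq_mult' _ _ _ _ Lg LBB)
    (is_lim_seq_mult' _ _ _ _ Lp LAB)) _).
  - exists N0. intros N HN. destruct (lcoef_Re_quotient (y N) N z (ev N HN)) as [_ P].
    rewrite Cmod2_alt in P. simpl in P. rewrite !Rmult_1_r in P.
    eapply Rle_trans; [exact P|]. right. ring.
  - right. ring. }
assert (P0 : 0 < PSeries c (Cmod z)) by (apply Hpos; lra).
assert (0 < Cmod (CPSeries c z) ^ 2) by nra.
assert (0 < PSeries (dcoef c) (Cmod z) * Cmod (CPSeries c z) ^ 2) by (apply Rmult_lt_0_compat; assumption).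
apply (Rmult_lt_reg_l (PSeries c (Cmod z))); [exact P0|]. lra.
Qed.

Lemma Cmod_pow_taylor (z y : C) (r : R) n :
  1 <= r -> Cmod z <= r -> Cmod y <= r ->
  Cmod (pow_n y (S n) - pow_n z (S n) - INR (S n) * (y - z) * pow_n z n) <=
  Cmod (y - z) ^ 2 * (INR (S n) ^ 2 * r ^ S n).
Proof.
intros Hr Hz Hy. set (w := Cmod (y - z)). assert (w0 : 0 <= w) by apply Cmod_ge_0.
induction n as [|n IH].
- change (pow_n y 1) with (y * 1)%C. change (pow_n z 1) with (z * 1)%C. change (pow_n z 0) with (RtoC 1).
  replace (y * 1 - z * 1 - INR 1 * (y - z) * 1)%C with (RtoC 0) by (change (INR 1) with 1; ring).
  rewrite Cmod_0. simpl. apply Rmult_le_pos; nra.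
- assert (E : (pow_n y (S (S n)) - pow_n z (S (S n)) - INR (S (S n)) * (y - z) * pow_n z (S n) =
    y * (pow_n y (S n) - pow_n z (S n) - INR (S n) * (y - z) * pow_n z n) +
    INR (S n) * ((y - z) * (y - z) * pow_n z n))%C).
  { rewrite (S_INR (S n)), RtoC_plus.
    change (pow_n y (S (S n))) with (y * pow_n y (S n))%C.
    change (pow_n z (S (S n))) with (z * (z * pow_n z n))%C.
    change (pow_n z (S n)) with (z * pow_n z n)%C. ring. }
  rewrite E. eapply Rle_trans; [apply Cmod_triangle|]. rewrite !Cmod_mult, Cmod_R, Cmod_pow_n.
  fold w. rewrite Rabs_pos_eq by apply pos_INR.
  assert (m0 := pos_INR (S n)). rewrite (S_INR (S n)). set (m := INR (S n)) in *.
  assert (rn : 0 <= r ^ n) by (apply pow_le; lra).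
  assert (zn : Cmod z ^ n <= r ^ n) by (apply pow_incr; split; [apply Cmod_ge_0|exact Hz]).
  assert (A : Cmod y * Cmod (pow_n y (S n) - pow_n z (S n) - m * (y - z) * pow_n z n) <=
              r * (w ^ 2 * (m ^ 2 * r ^ S n))).
  { apply Rmult_le_compat; [apply Cmod_ge_0|apply Cmod_ge_0|exact Hy|exact IH]. }
  assert (B : m * (w * w * Cmod z ^ n) <= m * (w * w * r ^ n)).
  { apply Rmult_le_compat_l; [exact m0|]. apply Rmult_le_compat_l; [nra|exact zn]. }
  assert (C : r ^ n <= r ^ S (S n)) by (apply Rle_pow; [exact Hr|lia]).
  assert (D : m * (w * w * r ^ n) <= m * (w * w * r ^ S (S n))).
  { apply Rmult_le_compat_l; [exact m0|]. apply Rmult_le_compat_l; [nra|exact C]. }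
  assert (F : 0 <= (m + 1) * (w * w * r ^ S (S n))).
  { apply Rmult_le_pos; [lra|]. apply Rmult_le_pos; [nra|lra]. }
  eapply Rle_trans; [apply Rplus_le_compat; [exact A|eapply Rle_trans; [exact B|exact D]]|].
  simpl in *. lra.
Qed.

Lemma ex_series_Re_S (c : nat -> R) z : entire c -> ex_series (fun n => c n * Re (pow_n z (S n))).
Proof.
intros H. apply (ex_series_incr_1 (fun n => PS_incr_1 c n * Re (pow_n z n))), ex_series_Re.
unfold entire. rewrite CV_radius_incr_1. exact H.
Qed.

Lemma ex_series_Im_S (c : nat -> R) z : entire c -> ex_series (fun n => c n * Im (pow_n z (S n))).
Proof.
intros H. apply (ex_series_incr_1 (fun n => PS_incr_1 c n * Im (pow_n z n))), ex_series_Im.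
unfold entire. rewrite CV_radius_incr_1. exact H.
Qed.

Lemma ex_series_minus_R (a b : nat -> R) : ex_series a -> ex_series b -> ex_series (fun n => a n - b n).
Proof. exact (ex_series_minus (V := R_NormedModule) a b). Qed.

Lemma ex_series_plus_R (a b : nat -> R) : ex_series a -> ex_series b -> ex_series (fun n => a n + b n).
Proof. exact (ex_series_plus (V := R_NormedModule) a b). Qed.

Lemma CPSeries_taylor (c : nat -> R) (z y : C) : entire c ->
  let e n := (pow_n y (S n) - pow_n z (S n) - INR (S n) * (y - z) * pow_n z n)%C in
  (y * CPSeries c y - z * CPSeries c z - (y - z) * CPSeries (dcoef c) z)%C =
  (Series (fun n => c n * Re (e n)), Series (fun n => c n * Im (e n))).
Proof.
intros H e. assert (Hd := entire_dcoef c H).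
set (w := (y - z)%C) in *.
assert (sR := fun k => ex_series_scal k _ (ex_series_Re _ z Hd) : ex_series (fun n => k * (dcoef c n * Re (pow_n z n)))).
assert (sI := fun k => ex_series_scal k _ (ex_series_Im _ z Hd) : ex_series (fun n => k * (dcoef c n * Im (pow_n z n)))).
assert (Ry := ex_series_Re_S c y H). assert (Rz := ex_series_Re_S c z H).
assert (Iy := ex_series_Im_S c y H). assert (Iz := ex_series_Im_S c z H).
apply injective_projections.
- transitivity (Re (y * CPSeries c y) - Re (z * CPSeries c z) -
    (Re w * Series (fun n => dcoef c n * Re (pow_n z n)) - Im w * Series (fun n => dcoef c n * Im (pow_n z n))));
    [reflexivity|].
  rewrite <- !Series_Re_S, <- !Series_scal_l by exact H.
  rewrite <- !Series_minus by auto using ex_series_minus_R.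
  apply Series_ext; intros n. unfold e, dcoef, PS_derive, PS_incr_1.
  generalize (INR (S n)) (pow_n y (S n)) (pow_n z (S n)) (pow_n z n).
  intros m [p1 p2] [r1 r2] [s1 s2]. destruct w as [w1 w2]. simpl. ring.
- transitivity (Im (y * CPSeries c y) - Im (z * CPSeries c z) -
    (Re w * Series (fun n => dcoef c n * Im (pow_n z n)) + Im w * Series (fun n => dcoef c n * Re (pow_n z n))));
    [reflexivity|].
  rewrite <- !Series_Im_S, <- !Series_scal_l by exact H.
  rewrite <- Series_plus, <- !Series_minus by auto using ex_series_minus_R, ex_series_plus_R.
  apply Series_ext; intros n. unfold e, dcoef, PS_derive, PS_incr_1.
  generalize (INR (S n)) (pow_n y (S n)) (pow_n z (S n)) (pow_n z n).
  intros m [p1 p2] [r1 r2] [s1 s2]. destruct w as [w1 w2]. simpl. ring.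
Qed.

Lemma is_derive_mul_CPSeries (c : nat -> R) (z : C) : entire c ->
  @is_derive C_AbsRing C_NormedModule (fun y => y * CPSeries c y)%C z (CPSeries (dcoef c) z).
Proof.
intros H. split; [apply is_linear_scal_l|].
intros x Hx. apply (@is_filter_lim_locally_unique C_AbsRing (AbsRing_NormedModule C_AbsRing)) in Hx. subst x. intros eps.
set (r := Cmod z + 1). assert (r1 : 1 <= r) by (unfold r; assert (A := Cmod_ge_0 z); lra).
set (M := fun n => Rabs (dcoef (dcoef c) n * r ^ n) * r).
assert (HM : ex_series M).
{ apply ex_series_scal_r, entire_ex_series_Rabs, entire_dcoef, entire_dcoef, H. }
set (K := sqrt 2 * Series M).
assert (M0 : forall n, 0 <= M n) by (intros; apply Rmult_le_pos; [apply Rabs_pos|lra]).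
assert (s0 : 0 <= Series M).
{ rewrite <- (Rmult_0_l (Series M)), <- Series_scal_l. apply Series_le; [|exact HM].
  intros n. specialize (M0 n). lra. }
assert (K0 : 0 <= K) by (apply Rmult_le_pos; [apply sqrt_pos|exact s0]).
assert (dpos : 0 < Rmin 1 (eps / (K + 1))).
{ apply Rmin_pos; [lra|]. apply Rdiv_lt_0_compat; [apply cond_pos|lra]. }
exists (mkposreal _ dpos). intros y Hy. change (Cmod (y - z) < Rmin 1 (eps / (K + 1))) in Hy.
change (Cmod (y * CPSeries c y - z * CPSeries c z - (y - z) * CPSeries (dcoef c) z) <= eps * Cmod (y - z)).
set (w := Cmod (y - z)) in *. assert (w0 : 0 <= w) by apply Cmod_ge_0.
assert (w1 : w < 1) by (eapply Rlt_le_trans; [exact Hy|apply Rmin_l]).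
assert (w2 : w < eps / (K + 1)) by (eapply Rlt_le_trans; [exact Hy|apply Rmin_r]).
assert (zr : Cmod z <= r) by (unfold r; lra).
assert (yr : Cmod y <= r).
{ replace y with ((y - z) + z)%C by ring. eapply Rle_trans; [apply Cmod_triangle|]. fold w. unfold r; lra. }
rewrite CPSeries_taylor by exact H.
set (e := fun n => (pow_n y (S n) - pow_n z (S n) - INR (S n) * (y - z) * pow_n z n)%C).
assert (B : forall n x, Rabs x <= Cmod (e n) -> Rabs (c n * x) <= w ^ 2 * M n).
{ intros n x Hx. assert (T := Cmod_pow_taylor z y r n r1 zr yr). fold w in T. fold (e n) in T.
  rewrite Rabs_mult.
  replace (w ^ 2 * M n) with (Rabs (c n) * (w ^ 2 * (INR (S n) ^ 2 * r ^ S n))).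
  - apply Rmult_le_compat_l; [apply Rabs_pos|eapply Rle_trans; [exact Hx|exact T]].
  - unfold M, dcoef, PS_derive, PS_incr_1. rewrite !Rabs_mult, (Rabs_pos_eq (INR _)) by apply pos_INR.
    rewrite (Rabs_pos_eq (r ^ n)) by (apply pow_le; lra). cbn [pow]. ring. }
assert (HwM : ex_series (fun n => w ^ 2 * M n)) by (apply (ex_series_scal (w ^ 2) M), HM).
assert (S1 : forall u : nat -> R, (forall n, Rabs (u n) <= w ^ 2 * M n) -> Rabs (Series u) <= w ^ 2 * Series M).
{ intros u Hu. rewrite <- Series_scal_l.
  eapply Rle_trans; [apply Series_Rabs|apply Series_le].
  - apply (ex_series_le_R _ (fun n => w ^ 2 * M n)); [|exact HwM]. intros n. rewrite Rabs_Rabsolu. apply Hu.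
  - intros n; split; [apply Rabs_pos|apply Hu].
  - exact HwM. }
eapply Rle_trans; [apply Cmod_2Rmax|]. cbn [fst snd].
assert (RM : Rmax (Rabs (Series (fun n => c n * Re (e n)))) (Rabs (Series (fun n => c n * Im (e n)))) <= w ^ 2 * Series M).
{ apply Rmax_lub; apply S1; intros n; apply B; [apply re_le_Cmod|apply Rabs_Im_le]. }
eapply Rle_trans; [apply Rmult_le_compat_l; [apply sqrt_pos|exact RM]|].
replace (sqrt 2 * (w ^ 2 * Series M)) with (w * K * w) by (unfold K; ring).
apply Rmult_le_compat_r; [exact w0|].
apply (Rmult_lt_compat_r (K + 1)) in w2; [|lra].
unfold Rdiv in w2. rewrite Rmult_assoc, Rinv_l, Rmult_1_r in w2 by lra. nra.
Qed.

Lemma h3_CPSeries nu q z : entire (hcoef nu q) -> h3 nu q z = (z * CPSeries (hcoef nu q) z)%C.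
Proof.
intros H. apply injective_projections; [apply (Series_Re_S _ z H)|apply (Series_Im_S _ z H)].
Qed.

(** * The Hahn-Exton function *)

Lemma qpoch_lprod a q n : qpoch a q n = lprod (fun k => a * q ^ k) n 1.
Proof. induction n as [|n IH]; simpl; [reflexivity|]. rewrite IH. ring. Qed.

Lemma qpoch_inf_pos a q : 0 < q < 1 -> 0 < a < 1 -> 0 < qpoch_inf a q.
Proof.
intros Hq Ha.
set (m := exp (- (1 * (a / (1 - q)) / (1 - a)))).
assert (low : forall n, m <= qpoch a q n).
{ intros n. rewrite qpoch_lprod.
  eapply Rle_trans; [|apply (lprod_ge_exp _ n 1 a)]; [|lra|lra|].
  - assert (S : rsum (fun k => a * q ^ k) n = a * (1 - q ^ n) / (1 - q)).
    { induction n as [|n IH]; simpl; [field; lra|]. rewrite IH. field. lra. }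
    assert (rsum (fun k => a * q ^ k) n <= a / (1 - q)).
    { rewrite S. apply Rmult_le_compat_r; [left; apply Rinv_0_lt_compat; lra|].
      assert (0 < q ^ n) by (apply pow_lt; lra). nra. }
    assert (X : - (1 * (a / (1 - q)) / (1 - a)) <= - (1 * rsum (fun k => a * q ^ k) n / (1 - a))).
    { apply Ropp_le_contravar, Rmult_le_compat_r; [left; apply Rinv_0_lt_compat; lra|lra]. }
    destruct X as [X|X]; [left; apply exp_increasing, X | right; unfold m; rewrite X; reflexivity].
  - intros k _. assert (0 < q ^ k <= 1).
    { split; [apply pow_lt; lra|]. rewrite <- (pow1 k). apply pow_incr; lra. } nra. }
destruct (ex_finite_lim_seq_decr (qpoch a q) m) as [l Hl].
- intros n. assert (P := qpoch_pos a q n Hq Ha). simpl.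
  assert (0 < q ^ n) by (apply pow_lt; lra). assert (0 <= a * q ^ n) by nra. nra.
- exact low.
- unfold qpoch_inf. change (0 < real (Lim_seq (qpoch a q))).
  rewrite (is_lim_seq_unique _ _ Hl).
  assert (m <= l) by exact (is_lim_seq_le _ _ m l low (is_lim_seq_const m) Hl).
  assert (0 < m) by apply exp_pos. simpl. lra.
Qed.

Lemma J3_PSeries nu q r : 0 < r ->
  J3 nu q r = qpoch_inf (q ^^ (nu + 1)) q / qpoch_inf q q *
    (r ^^ (nu - 2) * (r ^ 2 * PSeries (hcoef nu q) (r ^ 2))).
Proof.
intros Hr. unfold J3. f_equal. rewrite <- Rmult_assoc.
replace (r ^^ (nu - 2) * r ^ 2) with (r ^^ nu).
- unfold PSeries. rewrite <- Series_scal_l. apply Series_ext; intros n.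
  rewrite Rpower_plus. replace (2 * INR n) with (INR (2 * n)) by (rewrite mult_INR; reflexivity).
  rewrite Rpower_pow, pow_mult by exact Hr. unfold hcoef, Rdiv. ring.
- rewrite <- (Rpower_pow 2) by exact Hr. rewrite <- Rpower_plus. f_equal. simpl. ring.
Qed.

Lemma J3_equation nu q s : 0 < s -> entire (hcoef nu q) ->
  s * Derive (J3 nu q) s - (nu - 2) * J3 nu q s =
  2 * (qpoch_inf (q ^^ (nu + 1)) q / qpoch_inf q q) * s ^^ nu * PSeries (dcoef (hcoef nu q)) (s ^ 2).
Proof.
intros Hs H. set (K := qpoch_inf (q ^^ (nu + 1)) q / qpoch_inf q q).
set (c := hcoef nu q) in *.
assert (D : is_derive (J3 nu q) s
  (K * ((nu - 2) * s ^^ (nu - 2 - 1) * (s ^ 2 * PSeries c (s ^ 2)) +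
        s ^^ (nu - 2) * (PSeries (dcoef c) (s ^ 2) * (2 * s))))).
{ apply (is_derive_ext_loc (fun r => K * (r ^^ (nu - 2) * (r ^ 2 * PSeries c (r ^ 2))))).
  - apply (filter_imp (fun r => 0 < r)); [|apply (open_gt 0), Hs].
    intros r Hr. symmetry. apply J3_PSeries, Hr.
  - apply is_derive_Reals, derivable_pt_lim_scal.
    apply (derivable_pt_lim_mult (fun r => r ^^ (nu - 2)) (fun r => r ^ 2 * PSeries c (r ^ 2))).
    + apply derivable_pt_lim_power, Hs.
    + apply (derivable_pt_lim_comp (fun r => r ^ 2) (fun x => x * PSeries c x)).
      * replace (2 * s) with (INR 2 * s ^ pred 2) by (simpl; ring). apply derivable_pt_lim_pow.
      * apply is_derive_Reals, is_derive_mul_PSeries, H. }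
rewrite (is_derive_unique _ _ _ D), J3_PSeries by exact Hs. fold K c.
assert (E1 : s * s ^^ (nu - 2 - 1) = s ^^ (nu - 2)).
{ rewrite <- (Rpower_1 s Hs) at 1. rewrite <- Rpower_plus. f_equal. ring. }
assert (E2 : s ^ 2 * s ^^ (nu - 2) = s ^^ nu).
{ rewrite <- (Rpower_pow 2) by exact Hs. rewrite <- Rpower_plus. f_equal. simpl. ring. }
rewrite <- E2, <- E1. simpl. ring.
Qed.

Lemma Re_div_pos (a b : C) : 0 < Re (a * Cconj b) -> b <> 0 /\ 0 < Re (a / b).
Proof.
intros H. assert (Hb : b <> 0).
{ intros ->. revert H. simpl. lra. }
split; [exact Hb|]. apply Cmod_gt_0 in Hb. assert (M := Cmod2_alt b).
destruct a as [a1 a2], b as [b1 b2]. simpl in H, M |- *.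
assert (0 < b1 * (b1 * 1) + b2 * (b2 * 1)) by nra.
replace (a1 * (b1 / (b1 * (b1 * 1) + b2 * (b2 * 1))) - a2 * (- b2 / (b1 * (b1 * 1) + b2 * (b2 * 1))))
  with ((a1 * b1 - a2 * - b2) / (b1 * (b1 * 1) + b2 * (b2 * 1))) by (field; nra).
apply Rdiv_lt_0_compat; assumption.
Qed.

Lemma h3_radius_starlike nu q t : 0 < q < 1 -> 0 < q ^^ (nu + 1) < 1 -> 0 < t ->
  PSeries (dcoef (hcoef nu q)) t = 0 ->
  (forall s, 0 <= s < t -> 0 < PSeries (dcoef (hcoef nu q)) s) ->
  (forall s, 0 <= s <= t -> 0 < PSeries (hcoef nu q) s) ->
  is_radius_starlike (h3 nu q) t.
Proof.
intros Hq Hb Ht Hz Hd Hg.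
assert (Ent : entire (hcoef nu q)) by exact (entire_qcoef _ q Hq Hb).
destruct (qcoef_lp_approx _ q Hq Hb) as [y [_ [Hy _]]].
assert (der : forall z, @is_derive C_AbsRing C_NormedModule (h3 nu q) z (CPSeries (dcoef (hcoef nu q)) z)).
{ intros z. apply (is_derive_ext (fun y => y * CPSeries (hcoef nu q) y)%C).
  - intros x. symmetry. apply h3_CPSeries, Ent.
  - apply is_derive_mul_CPSeries, Ent. }
split.
- intros r [Hr Hs]. destruct (Rle_dec r t) as [A|A]; [exact A|exfalso].
  destruct (Hs (RtoC t)) as [l [Hl P]].
  { rewrite Cmod_R, Rabs_pos_eq; lra. }
  assert (E : l = RtoC 0).
  { rewrite <- (is_C_derive_unique _ _ _ Hl), (is_C_derive_unique _ _ _ (der (RtoC t))).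
    rewrite CPSeries_RtoC, Hz. reflexivity. }
  rewrite E in P. unfold Cdiv in P. rewrite Cmult_0_r, Cmult_0_l in P. simpl in P. lra.
- intros u Hu. apply Hu. split; [exact Ht|]. intros z Hzt.
  exists (CPSeries (dcoef (hcoef nu q)) z). split; [apply der|].
  destruct (Re_div_pos (CPSeries (dcoef (hcoef nu q)) z) (CPSeries (hcoef nu q) z)) as [N P].
  { apply (lp_Re_quotient_pos _ y); [exact Hy|lra| |apply Hd; lra].
    intros s Hs. apply Hg. lra. }
  rewrite h3_CPSeries by exact Ent.
  replace (z * CPSeries (dcoef (hcoef nu q)) z / (z * CPSeries (hcoef nu q) z))%C
    with (CPSeries (dcoef (hcoef nu q)) z / CPSeries (hcoef nu q) z)%C; [exact P|].
  field. split; [exact N|]. apply Cmod_gt_0. lra.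
Qed.

Lemma newton_dcoef_qcoef b q : 0 < q < 1 -> 0 < b < 1 ->
  let n := newton (dcoef (qcoef b q)) in
  n 1%nat = 2 * q / ((1 - q) * (1 - b)) /\
  n 2%nat = 2 * q ^ 2 * (2 - q + b * q - 2 * (b * q ^ 2)) /
    ((1 - q) ^ 2 * (1 - b) ^ 2 * (1 + q) * (1 - b * q)) /\
  n 3%nat = 2 * q ^ 3 *
    (4 - q - q ^ 2 + q ^ 3 + b * (5 * q - 3 * q ^ 2 - 10 * q ^ 3 - 3 * q ^ 4 + 5 * q ^ 5)
     + b ^ 2 * (q ^ 3 - q ^ 4 - q ^ 5 + 4 * q ^ 6)) /
    ((1 - q) ^ 3 * (1 - b) ^ 3 * (1 - b * q) * (1 - b * q ^ 2) * (1 + q) * (1 + q + q ^ 2)).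
Proof.
intros Hq Hb n.
assert (H0 : qcoef b q 0 = 1) by (unfold qcoef; simpl; field).
assert (bq : b * q < 1) by nra. assert (bq2 : b * q ^ 2 < 1) by nra.
assert (q2 : q * q < 1) by nra. assert (q3 : q * (q * q) < 1) by nra.
unfold n, newton, dcoef, PS_derive, PS_incr_1. rewrite !qcoef_S, H0 by assumption.
rewrite !S_INR. simpl INR. 
split; [|split]; simpl; field; repeat split; nra.
Qed.

Lemma Rpower_add_nat q x n : 0 < q -> q ^^ (x + INR n) = q ^^ x * q ^ n.
Proof. intros Hq. rewrite Rpower_plus, Rpower_pow by exact Hq. reflexivity. Qed.

Theorem theorem6 (q nu : R) (hq : 0 < q < 1) (hnu : -1 < nu) :
  exists rho : R,
    (* rho is the smallest positive root of r J'(r) - (nu-2) J(r) = 0 *)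
    0 < rho /\
    rho * Derive (J3 nu q) rho - (nu - 2) * J3 nu q rho = 0 /\
    (forall s, 0 < s < rho -> s * Derive (J3 nu q) s - (nu - 2) * J3 nu q s <> 0) /\
    (* r*(h) = rho^2 (h is a function of z = r^2, see NOTES.md) *)
    is_radius_starlike (h3 nu q) (rho ^ 2) /\
    (1 - q) * (1 - q ^^ (nu + 1)) / (2 * q) < rho ^ 2 /\
    rho ^ 2 < (q ^ 2 - 1) * (q ^^ (nu + 1) - 1) * (q ^^ (nu + 2) - 1)
              / (q * (q - q ^^ (nu + 2) + 2 * q ^^ (nu + 3) - 2)) /\
    (q - 1) * (q ^^ (nu + 1) - 1) / (2 * q) *
      sqrt (2 * (q ^^ (nu + 2) - 1) * (q + 1) / (q - q ^^ (nu + 2) + 2 * q ^^ (nu + 3) - 2))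
      < rho ^ 2 /\
    rho ^ 2 < (q ^^ (nu + 1) - 1) * (q ^^ (nu + 3) - 1) * (1 - q) / (q * (q + 1)) *
      ((q - q ^^ (nu + 2) + 2 * q ^^ (nu + 3) - 2) * (q ^ 3 + 2 * q ^ 2 + 2 * q + 1)
       / (q + q ^ 2 - q ^ 3 - 4 - 5 * q ^^ (nu + 2) + 3 * q ^^ (nu + 3)
          + 10 * q ^^ (nu + 4) + 3 * q ^^ (nu + 5) - 5 * q ^^ (nu + 6)
          - q ^^ (2 * nu + 5) + q ^^ (2 * nu + 6) + q ^^ (2 * nu + 7)
          - 4 * q ^^ (2 * nu + 8))).
Proof.
set (b := q ^^ (nu + 1)).
assert (Hb : 0 < b < 1).
{ split; [apply exp_pos|]. rewrite <- (Rpower_O q) by lra. unfold b, Rpower.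
  apply exp_increasing. assert (ln q < 0) by (rewrite <- ln_1; apply ln_increasing; lra). nra. }
assert (Pb : forall n x, x = nu + 1 + INR n -> q ^^ x = b * q ^ n).
{ intros n x ->. apply Rpower_add_nat. lra. }
assert (Pbb : forall n x, x = nu + 1 + (nu + 1) + INR n -> q ^^ x = b ^ 2 * q ^ n).
{ intros n x ->. rewrite Rpower_add_nat, Rpower_plus by lra. fold b. ring. }
rewrite (Pb 1%nat (nu + 2)), (Pb 2%nat (nu + 3)), (Pb 3%nat (nu + 4)), (Pb 4%nat (nu + 5)),
  (Pb 5%nat (nu + 6)), (Pbb 3%nat (2 * nu + 5)), (Pbb 4%nat (2 * nu + 6)),
  (Pbb 5%nat (2 * nu + 7)), (Pbb 6%nat (2 * nu + 8)) by (simpl; ring).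
destruct (dcoef_first_zero b q hq Hb) as [t [Ht [Hz [Hd [Hg [Hn He]]]]]].
destruct (He 1%nat ltac:(lia)) as [L1 U1]. destruct (He 2%nat ltac:(lia)) as [L2 U2].
assert (N2 := Hn 2%nat ltac:(lia)). assert (N3 := Hn 3%nat ltac:(lia)). clear Hn He.
destruct (newton_dcoef_qcoef b q hq Hb) as [E1 [E2 E3]].
rewrite E1 in L1, U1. rewrite E2 in U1, L2, U2, N2. rewrite E3 in U2, N3. clear E1 E2 E3.
assert (Ent : entire (hcoef nu q)) by exact (entire_qcoef b q hq Hb).
assert (b1 : 0 < 1 - b) by lra. assert (q1 : 0 < 1 - q) by lra.
assert (bq : 0 < 1 - b * q) by nra. assert (bq2 : 0 < 1 - b * q ^ 2) by (simpl; nra).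
set (D := 2 - q + b * q - 2 * (b * q ^ 2)) in *.
set (E := 4 - q - q ^ 2 + q ^ 3 + b * (5 * q - 3 * q ^ 2 - 10 * q ^ 3 - 3 * q ^ 4 + 5 * q ^ 5)
  + b ^ 2 * (q ^ 3 - q ^ 4 - q ^ 5 + 4 * q ^ 6)) in *.
assert (dD : 0 < (1 - q) ^ 2 * (1 - b) ^ 2 * (1 + q) * (1 - b * q)).
{ repeat apply Rmult_lt_0_compat; try apply pow_lt; lra. }
assert (dE : 0 < (1 - q) ^ 3 * (1 - b) ^ 3 * (1 - b * q) * (1 - b * q ^ 2) * (1 + q) * (1 + q + q ^ 2)).
{ repeat apply Rmult_lt_0_compat; try apply pow_lt; nra. }
assert (q2 : 0 < q ^ 2) by (apply pow_lt; lra). assert (q3 : 0 < q ^ 3) by (apply pow_lt; lra).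
assert (numpos : forall k n d, 0 < k -> 0 < d -> 0 < k * n / d -> 0 < n).
{ intros k n d Hk Hd0 H. destruct (Rlt_dec 0 n) as [A|A]; [exact A|exfalso].
  assert (0 < / d) by (apply Rinv_0_lt_compat, Hd0). unfold Rdiv in H.
  assert (k * n <= 0) by nra. nra. }
assert (D0 : 0 < D) by (apply (numpos (2 * q ^ 2) D _ ltac:(lra) dD N2)).
assert (E0 : 0 < E) by (apply (numpos (2 * q ^ 3) E _ ltac:(lra) dE N3)).
assert (rho2 : sqrt t ^ 2 = t) by (apply pow2_sqrt; lra).
assert (rho0 : 0 < sqrt t) by (apply sqrt_lt_R0, Ht).
exists (sqrt t). rewrite rho2. split; [exact rho0|].
split; [|split; [|split; [|split; [|split; [|split]]]]].
- rewrite J3_equation, rho2 by assumption.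
  change (hcoef nu q) with (qcoef b q). rewrite Hz. ring.
- intros s Hs. rewrite J3_equation by (assumption || lra).
  change (hcoef nu q) with (qcoef b q). fold b.
  assert (0 < PSeries (dcoef (qcoef b q)) (s ^ 2)).
  { apply Hd. rewrite <- rho2. split; [apply pow_le; lra|]. simpl. nra. }
  assert (A1 := qpoch_inf_pos b q hq Hb). assert (A2 := qpoch_inf_pos q q hq hq).
  assert (A3 := exp_pos (nu * ln s)). change (exp (nu * ln s)) with (s ^^ nu) in A3.
  assert (0 < qpoch_inf b q / qpoch_inf q q) by (apply Rdiv_lt_0_compat; assumption).
  apply Rgt_not_eq, Rmult_lt_0_compat; [|assumption].
  apply Rmult_lt_0_compat; [lra|assumption].
- apply h3_radius_starlike; assumption.
- rewrite pow_1 in L1.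
  replace ((1 - q) * (1 - b) / (2 * q)) with (/ (2 * q / ((1 - q) * (1 - b)))) by (field; lra).
  rewrite <- (Rinv_inv t). apply Rinv_lt_contravar; [|exact L1].
  apply Rmult_lt_0_compat; [apply Rinv_0_lt_compat, Ht|].
  apply Rdiv_lt_0_compat; [lra|apply Rmult_lt_0_compat; assumption].
- replace ((q ^ 2 - 1) * (b - 1) * (b * q ^ 1 - 1) / (q * (q - b * q ^ 1 + 2 * (b * q ^ 2) - 2))) with
    ((2 * q / ((1 - q) * (1 - b))) / (2 * q ^ 2 * D / ((1 - q) ^ 2 * (1 - b) ^ 2 * (1 + q) * (1 - b * q)))).
  + apply Rlt_div_r; [exact N2|exact U1].
  + replace (q - b * q ^ 1 + 2 * (b * q ^ 2) - 2) with (- D) by (unfold D; ring). field.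
    repeat split; lra.
- replace ((q - 1) * (b - 1) / (2 * q)) with ((1 - q) * (1 - b) / (2 * q)) by (field; lra).
  set (m := (1 - q) * (1 - b) / (2 * q)).
  assert (m0 : 0 < m) by (apply Rdiv_lt_0_compat; [apply Rmult_lt_0_compat|]; lra).
  replace (2 * (b * q ^ 1 - 1) * (q + 1) / (q - b * q ^ 1 + 2 * (b * q ^ 2) - 2)) with
    (2 * (1 - b * q) * (1 + q) / D).
  + set (S := 2 * (1 - b * q) * (1 + q) / D).
    assert (S0 : 0 < S) by (apply Rdiv_lt_0_compat; [repeat apply Rmult_lt_0_compat|]; lra).
    assert (M : m ^ 2 * S < t ^ 2).
    { rewrite <- (Rinv_inv (t ^ 2)).
      replace (m ^ 2 * S) with (/ (2 * q ^ 2 * D / ((1 - q) ^ 2 * (1 - b) ^ 2 * (1 + q) * (1 - b * q)))).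
      - apply Rinv_lt_contravar; [|exact L2].
        apply Rmult_lt_0_compat; [apply Rinv_0_lt_compat, pow_lt, Ht|exact N2].
      - unfold m, S. field. repeat split; lra. }
    assert (sS := pow2_sqrt S ltac:(lra)). assert (sS0 := sqrt_pos S).
    destruct (Rlt_dec (m * sqrt S) t) as [A|A]; [exact A|exfalso].
    assert (t ^ 2 <= (m * sqrt S) ^ 2) by (apply pow_incr; lra).
    rewrite Rpow_mult_distr, sS in H. lra.
  + replace (q - b * q ^ 1 + 2 * (b * q ^ 2) - 2) with (- D) by (unfold D; ring). field. lra.
- match goal with |- t < ?R => replace R with
    ((2 * q ^ 2 * D / ((1 - q) ^ 2 * (1 - b) ^ 2 * (1 + q) * (1 - b * q))) /
     (2 * q ^ 3 * E / ((1 - q) ^ 3 * (1 - b) ^ 3 * (1 - b * q) * (1 - b * q ^ 2) * (1 + q) * (1 + q + q ^ 2)))) end.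
  + apply Rlt_div_r; [exact N3|exact U2].
  + replace (q - b * q ^ 1 + 2 * (b * q ^ 2) - 2) with (- D) by (unfold D; ring).
    match goal with |- _ = _ * (_ / ?d) => replace d with (- E) by (unfold E; ring) end.
    field. repeat split; nra.
Qed.
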